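(* Let $a$ and $b$ be bounded operators in $H$ and let $M,N$ be nonnegative integers. Then: (1) $a\in\mathcal{K}^\infty$ if and only if $\|a\|_{M,N}<\infty$ for all nonnegative integers $M$ and $N$. (2) $\|a\|_{M+1,N}=\|a\|_{M,N}+\|\delta_{\mathbb{K}}(a)\|_{M,N}$. (3) $\|a\|_{M,N}\le\|a\|_{M,N+1}$. (4) $\|ab\|_{M,N}\le\|a\|_{M,0}\|b\|_{M,N}\le\|a\|_{M,N}\|b\|_{M,N}$. (5) $\|\delta_{\mathbb{K}}(a)\|_{M,N}\le\|a\|_{M+1,N}$. (6) $\|a^*\|_{M,N}\le\|a\|_{M+N,N}$. (7) $\mathcal{K}^\infty$, with the topology defined by the norms $\|\cdot\|_{M,N}$, is a complete topological vector space.
   Context: $H$ is a separable infinite-dimensional complex Hilbert space with a fixed orthonormal basis $\{E_k\}_{k\ge0}$; $P_{k,l}$ is the operator with $P_{k,l}E_l=E_k$ and $P_{k,l}E_m=0$ for $m\ne l$. $\mathcal{K}^\infty$ is the set of operators $c=\sum_{k,l\ge0}c_{k,l}P_{k,l}$ with rapidly decaying coefficients: $\sup_{k,l}(1+k)^M(1+l)^N|c_{k,l}|<\infty$ for all $M,N\ge0$. $\mathbb{K}$ is the unbounded diagonal operator $\mathbb{K}E_k=kE_k$. Define $\delta_{\mathbb{K}}(a)=[\mathbb{K},a]$, $\|a\|_{0,N}=\|a(I+\mathbb{K})^N\|\in[0,\infty]$, and $$\|a\|_{M,N}=\sum_{j=0}^M\binom Mj\|\delta_{\mathbb{K}}^j(a)\|_{0,N}\in[0,\infty],\qquad\delta_{\mathbb{K}}^0(a)=a.$$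 For a general bounded operator $a$ with matrix coefficients $a_{k,l}$ these are understood through matrices: $\delta_{\mathbb{K}}^j(a)$ is the matrix $((k-l)^ja_{k,l})$, and $\|\delta_{\mathbb{K}}^j(a)\|_{0,N}$ is the operator norm of the matrix $((k-l)^j(1+l)^Na_{k,l})$, equal to $\infty$ if this matrix does not define a bounded operator. Products of the form $0\cdot\infty$ are read as $0$. *)

(* Defs.v *)
From HB Require Import structures.
From mathcomp Require Import all_boot all_order all_algebra.
From mathcomp Require Import complex.
From mathcomp Require Import all_classical all_reals all_analysis.

Set Implicit Arguments.
Unset Strict Implicit.
Unset Printing Implicit Defensive.

Import Order.TTheory GRing.Theory Num.Def Num.Theory.
Import numFieldNormedType.Exports.

Local Open Scope classical_set_scope.
Local Open Scope complex_scope.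
Local Open Scope ring_scope.

(* The inner product is linear in its first argument, as in [{dot H for conjC}]. *)
Definition norm_from_dot (R : realType) (H : completeNormedModType R[i])
    (ip : {dot H for conjC}) : Prop :=
  forall x : H, ip x x = `|x| ^+ 2.

Definition orthonormal_basis (R : realType) (H : completeNormedModType R[i])
    (ip : {dot H for conjC}) (E : nat -> H) : Prop :=
  (forall k l, ip (E k) (E l) = (k == l)%:R) /\
  dense [set x | exists n (c : nat -> R[i]), x = \sum_(k < n) c k *: E k].

Definition bounded_operator (R : realType) (H : completeNormedModType R[i])
    (T : H -> H) : Prop :=
  linear T /\ exists C : R[i], forall x, `|T x| <= C * `|x|.

Definition is_adjoint (R : realType) (H : completeNormedModType R[i])
    (ip : {dot H for conjC}) (T S : H -> H) : Prop :=
  forall x y, ip (T x) y = ip x (S y).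

(* The norm of [H] takes its values in [R[i]], hence the real part. *)
Definition opnorm (R : realType) (H : completeNormedModType R[i])
    (T : H -> H) : \bar R :=
  ereal_sup [set (complex.Re `|T x|)%:E | x in [set x : H | `|x| <= 1]].

Definition mxcoef (R : realType) (H : completeNormedModType R[i])
    (ip : {dot H for conjC}) (E : nat -> H) (T : H -> H) : nat -> nat -> R[i] :=
  fun k l => ip (T (E l)) (E k).

(* A bounded operator is determined by its matrix, so the infimum ranges over at
   most one value; it is +oo when the matrix defines no bounded operator. *)
Definition mxopnorm (R : realType) (H : completeNormedModType R[i])
    (ip : {dot H for conjC}) (E : nat -> H) (m : nat -> nat -> R[i]) : \bar R :=
  ereal_inf [set opnorm T | T in [set T : H -> H |
    bounded_operator T /\ forall k l, mxcoef ip E T k l = m k l]].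

(* The matrix of [delta_K^j], where [delta_K] is the commutator with [K]. *)
Definition mxdelta (R : realType) (j : nat) (m : nat -> nat -> R[i]) :
    nat -> nat -> R[i] :=
  fun k l => (k%:R - l%:R) ^+ j * m k l.

Definition mxnorm0 (R : realType) (H : completeNormedModType R[i])
    (ip : {dot H for conjC}) (E : nat -> H) (N : nat)
    (m : nat -> nat -> R[i]) : \bar R :=
  mxopnorm ip E (fun k l => (1 + l%:R) ^+ N * m k l).

Definition mxnorm (R : realType) (H : completeNormedModType R[i])
    (ip : {dot H for conjC}) (E : nat -> H) (M N : nat)
    (m : nat -> nat -> R[i]) : \bar R :=
  (\sum_(j < M.+1) ('C(M, j)%:R)%:E * mxnorm0 ip E N (mxdelta j m))%E.

Definition norm_MN (R : realType) (H : completeNormedModType R[i])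
    (ip : {dot H for conjC}) (E : nat -> H) (M N : nat) (a : H -> H) : \bar R :=
  mxnorm ip E M N (mxcoef ip E a).

(* [delta_K a] need not be bounded, so its norms are those of its matrix. *)
Definition norm_MN_delta (R : realType) (H : completeNormedModType R[i])
    (ip : {dot H for conjC}) (E : nat -> H) (M N : nat) (a : H -> H) : \bar R :=
  mxnorm ip E M N (mxdelta 1 (mxcoef ip E a)).

Definition rapid_decay (R : realType) (c : nat -> nat -> R[i]) : Prop :=
  forall M N : nat, exists B : R[i], forall k l : nat,
    (1 + k%:R) ^+ M * (1 + l%:R) ^+ N * `|c k l| <= B.

Definition P_ (R : realType) (H : completeNormedModType R[i])
    (ip : {dot H for conjC}) (E : nat -> H) (k l : nat) (x : H) : H :=
  ip x (E l) *: E k.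

(* [a] is the sum of the [c_{k,l} P_{k,l}]. The mode of convergence is
   immaterial, as the series converges absolutely in operator norm. *)
Definition Kinfty (R : realType) (H : completeNormedModType R[i])
    (ip : {dot H for conjC}) (E : nat -> H) (a : H -> H) : Prop :=
  bounded_operator a /\
  exists2 c : nat -> nat -> R[i], rapid_decay c &
    forall x : H,
      (fun n : nat => \sum_(k < n) \sum_(l < n) c k l *: P_ ip E k l x) @ \oo
        --> a x.

Lemma bounded_operatorZD (R : realType) (H : completeNormedModType R[i])
    (z : R[i]) (S T : H -> H) :
  bounded_operator S -> bounded_operator T -> bounded_operator (z *: S + T).
Proof.
move=> [Sl [A SA]] [Tl [B TB]]; split.
  move=> u x y; rewrite !fctE Sl Tl !scalerDr !scalerA (mulrC z u) !addrA.
  by congr (_ + _); rewrite -!addrA; congr (_ + _); rewrite addrC.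
exists (`|z| * A + B) => x; rewrite mulrDl -mulrA.
apply: (le_trans (ler_normD _ _)); apply: lerD => //.
by rewrite fctE [leLHS]normrZ; apply: ler_wpM2l; [exact: normr_ge0|exact: SA].
Qed.

Lemma rapid_decayZD (R : realType) (z : R[i]) (c d : nat -> nat -> R[i]) :
  rapid_decay c -> rapid_decay d ->
  rapid_decay (fun k l => z * c k l + d k l).
Proof.
move=> hc hd M N; have [[A hA] [B hB]] := (hc M N, hd M N).
exists (`|z| * A + B) => k l.
set w := _ * _ ^+ N.
have w0 : 0 <= w.
  by rewrite mulr_ge0// exprn_ge0// addr_ge0// ler0n.
apply: (@le_trans _ _ (`|z| * (w * `|c k l|) + w * `|d k l|)).
  rewrite mulrCA -normrM -mulrDr; exact/ler_wpM2l/ler_normD.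
apply: lerD; last exact: hB.
by apply: ler_wpM2l; [exact: normr_ge0|exact: hA].
Qed.

Lemma KinftyZD (R : realType) (H : completeNormedModType R[i])
    (ip : {dot H for conjC}) (E : nat -> H) (z : R[i]) (a b : H -> H) :
  Kinfty ip E a -> Kinfty ip E b -> Kinfty ip E (z *: a + b).
Proof.
move=> [Ba [c hc ca]] [Bb [d hd db]]; split; first exact: bounded_operatorZD.
exists (fun k l => z * c k l + d k l); first exact: rapid_decayZD.
move=> x; under eq_fun => n.
  under eq_bigr => k _.
    under eq_bigr => l _ do rewrite scalerDl -scalerA.
    rewrite big_split/= -scaler_sumr; over.
  rewrite big_split/= -scaler_sumr; over.
by apply: cvgD; [apply: cvgZl_tmp; exact: ca|exact: db].
Qed.

Lemma Kinfty0 (R : realType) (H : completeNormedModType R[i])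
    (ip : {dot H for conjC}) (E : nat -> H) :
  Kinfty ip E (0 : H -> H).
Proof.
split.
  split; first by move=> u x y; rewrite [RHS]addr0 scaler0.
  by exists 0 => x; rewrite normr0 mul0r.
exists (fun _ _ => 0).
  by move=> M N; exists 0 => k l; rewrite normr0 mulr0.
move=> x; under eq_fun => n.
  rewrite big1; last by move=> k _; rewrite big1// => l _; rewrite scale0r.
  over.
exact: cvg_cst.
Qed.

Section kinfty_type.
Context (R : realType) (H : completeNormedModType R[i])
  (ip : {dot H for conjC}) (E : nat -> H).

Definition Kinfty_pred : {pred H -> H} := mem [set a | Kinfty ip E a].

Record kinfty : Type := MkKinfty {
  kinfty_fun : H -> H ;
  kinfty_funP : kinfty_fun \in Kinfty_pred }.

HB.instance Definition _ := [isSub for kinfty_fun].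
HB.instance Definition _ := gen_eqMixin kinfty.
HB.instance Definition _ := gen_choiceMixin kinfty.

Lemma Kinfty_submod_closed : submod_closed Kinfty_pred.
Proof.
split; first exact/mem_set/Kinfty0.
by move=> z a b /set_mem ha /set_mem hb; exact/mem_set/KinftyZD.
Qed.

HB.instance Definition _ :=
  GRing.isSubmodClosed.Build _ _ Kinfty_pred Kinfty_submod_closed.
HB.instance Definition _ := [SubChoice_isSubLmodule of kinfty by <:].
HB.instance Definition _ := isPointed.Build kinfty 0.

Definition Kinfty_ball (i : nat * nat * R * kinfty) : set kinfty :=
  let: (M, N, e, x) := i in
  [set y : kinfty | (norm_MN ip E M N (kinfty_fun (y - x)%R) < e%:E)%E].

(* The topology defined by the norms: the open balls of all the norms, with
   arbitrary centers, form a subbase. *)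
HB.instance Definition _ := isSubBaseTopological.Build kinfty
  [set i : nat * nat * R * kinfty | 0 < i.1.2] Kinfty_ball.
End kinfty_type.

Definition topological_vector_space (K : numFieldType)
    (V : preTopologicalLmodType K) : Prop :=
  continuous (fun x : V * V => x.1 + x.2) /\
  continuous (fun z : K^o * V => z.1 *: z.2).

(* Completeness for the uniform structure of the additive group: [V] need not be
   a [uniformType]. *)
Definition tvs_cauchy (K : numFieldType) (V : preTopologicalLmodType K)
    (F : set_system V) : Prop :=
  forall U : set V, nbhs 0 U ->
    exists2 A : set V, F A & forall x y, A x -> A y -> U (x - y).

Definition tvs_complete (K : numFieldType)
    (V : preTopologicalLmodType K) : Prop :=
  forall F : set_system V, ProperFilter F -> tvs_cauchy F -> exists x : V, F --> x.

(* Main.v *)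
Require Import Defs.
From HB Require Import structures.
From mathcomp Require Import all_boot all_order all_algebra.
From mathcomp Require Import complex.
From mathcomp Require Import all_classical all_reals all_analysis.
From mathcomp Require Import ring lra.
Import Order.TTheory GRing.Theory Num.Def Num.Theory.
Import numFieldNormedType.Exports.
Set Implicit Arguments.
Unset Strict Implicit.
Unset Printing Implicit Defensive.
Local Open Scope classical_set_scope.
Local Open Scope complex_scope.
Local Open Scope ring_scope.

(** A matrix [m] is the matrix of a bounded operator of norm at most [C] exactly
when all its finite square sections, acting on the span of finitely many basis
vectors, are bounded by [C]. This turns every norm inequality into one about
finite sums, in which positivity, adjoints, scalings and limits are transparent.

The binomial weights give the recursion
[|a|_(M+1,N) = |a|_(M,N) + |delta a|_(M,N)], so that the inequalities for
products and adjoints follow by induction on [M] from the Leibniz rule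
[delta (ab) = (delta a) b + a (delta b)] and from
[delta (a^* ) = - (delta a)^*]; rapid decay is read off
[1 + k <= (1 + |k - l|) (1 + l)]. Completeness holds because the norms are
lower semicontinuous, up to a factor [2 ^ M], for entrywise convergence. *)

(** * Norms and convergence with real values *)

Section real_norm.
Context {R : realType} {V : normedZmodType R[i]}.
Implicit Types x y : V.

(** The norms may be infinite and [delta a] is in general only a matrix, so estimates are proved for
    matrices with real bounds [C]. The way back, from bounded sections to an operator, is where
    completeness of [H] enters. Entries of a product [a \o b] are infinite sums, so the Leibniz rule
    is not a termwise identity. It is used only when the norms involved are finite: [delta a] and
    [delta b] are then matrices of bounded operators, and the rule, exact on finite truncations,
    passes to the limit. If a factor has infinite norm, the product estimate is trivial unless the
    other norm is zero; a vanishing norm forces the operator itself to vanish. The factor [2 ^ M]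
    comes from handing the same bound to both halves of the recursion. It is harmless for
    completeness, where the bound can be made as small as desired. *)

Definition nr x : R := complex.Re `|x|.

(** Norms have values in [R[i]], whose order is partial; this identity moves estimates to [R], where
    [lra], [nra] and suprema apply. *)
Lemma nrE x : `|x| = (nr x)%:C.
Proof. by rewrite /nr RRe_real// normr_real. Qed.

Lemma nr_ge0 x : 0 <= nr x.
Proof. by rewrite -ler0c -nrE. Qed.

Lemma nrD x y : nr (x + y) <= nr x + nr y.
Proof. by rewrite -lecR rmorphD/= -!nrE ler_normD. Qed.

Lemma nrN x : nr (- x) = nr x.
Proof. by rewrite /nr normrN. Qed.

Lemma nrB x y : nr (x - y) <= nr x + nr y.
Proof. by rewrite -[nr y]nrN nrD. Qed.

Lemma nr_distC x y : nr (x - y) = nr (y - x).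
Proof. by rewrite -nrN opprB. Qed.

Lemma nr_tri x y z : nr (x - z) <= nr (x - y) + nr (y - z).
Proof. by apply: le_trans (nrD _ _); rewrite addrA subrK. Qed.

Lemma nr0 : nr 0 = 0.
Proof. by rewrite /nr normr0. Qed.

Lemma nr_eq0 x : nr x = 0 -> x = 0.
Proof. by move=> x0; apply/normr0_eq0; rewrite nrE x0. Qed.

Lemma nr_sum (I : Type) (r : seq I) (P : pred I) (f : I -> V) :
  nr (\sum_(i <- r | P i) f i) <= \sum_(i <- r | P i) nr (f i).
Proof.
elim/big_rec2: _ => [|i y x _ h]; first by rewrite nr0.
by apply: le_trans (nrD _ _) _; rewrite lerD2l.
Qed.

End real_norm.

Section real_norm_scalar.
Context {R : realType}.

Lemma nrM (a b : R[i]) : nr (a * b) = nr a * nr b.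
Proof. by apply: complexI; rewrite rmorphM/= -!nrE normrM. Qed.

Lemma nrX (a : R[i]) n : nr (a ^+ n) = nr a ^+ n.
Proof. by apply: complexI; rewrite rmorphXn/= -!nrE normrX. Qed.

Lemma nr_real (a : R) : 0 <= a -> nr (a%:C) = a.
Proof. by move=> a0; apply: complexI; rewrite -nrE ger0_norm// ler0c. Qed.

Lemma nr_nat n : nr (n%:R : R[i]) = n%:R.
Proof. by apply: complexI; rewrite -nrE rmorph_nat normr_nat. Qed.

Lemma nrZ (V : normedModType R[i]) (a : R[i]) (x : V) : nr (a *: x) = nr a * nr x.
Proof. by apply: complexI; rewrite rmorphM/= -!nrE normrZ. Qed.

Lemma gt0_complexP (e : R[i]) : 0 < e -> exists2 d : R, 0 < d & e = d%:C.
Proof.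
move=> e0; exists (complex.Re e); last by rewrite RRe_real// gtr0_real.
by rewrite -ltcR RRe_real// gtr0_real.
Qed.

Lemma cvg_nrP (V : normedModType R[i]) (u : nat -> V) (l : V) :
  u @ \oo --> l <->
  forall e : R, 0 < e -> exists n0, forall n, (n0 <= n)%N -> nr (u n - l) <= e.
Proof.
split=> [ul e e0|h].
  have /cvgrPdist_le/(_ e%:C) := ul.
  rewrite ltcR => /(_ e0)[n0 _ hn0]; exists n0 => n n0n.
  by rewrite nr_distC -lecR -nrE; exact: hn0.
apply/cvgrPdist_le => _ /gt0_complexP[e e0 ->].
have [n0 hn0] := h e e0; exists n0 => // n n0n /=.
by rewrite nrE lecR nr_distC; exact: hn0.
Qed.

Lemma cvg_nr_cauchy (V : completeNormedModType R[i]) (u : nat -> V) :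
  (forall e : R, 0 < e -> exists n0, forall n, (n0 <= n)%N -> nr (u n - u n0) <= e) ->
  cvgn u.
Proof.
move=> h; apply/cauchy_cvgP/cauchy_ballP => _ /gt0_complexP[e e0 ->].
have [|n0 hn0] := h (e / 3); first by rewrite divr_gt0.
exists ([set u n | n in [set n | (n0 <= n)%N]],
        [set u n | n in [set n | (n0 <= n)%N]]).
  by split; exists n0 => // n /= n0n; exists n.
move=> [_ _] /= [[m n0m <-] [n n0n <-]]; rewrite -ball_normE/= nrE ltcR.
apply: le_lt_trans (nr_tri _ (u n0) _) _.
by have := hn0 _ n0m; have := hn0 _ n0n; rewrite (nr_distC (u n)); lra.
Qed.

Lemma cvg_nr_le (V : normedModType R[i]) (u : nat -> V) (l : V) (b : R) :
  u @ \oo --> l -> (forall n, nr (u n) <= b) -> nr l <= b.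
Proof.
move=> /cvg_nrP ul ub; apply/ler_addgt0Pr => e e0.
have [n /(_ n (leqnn n)) hn] := ul e e0.
by have := nrB (u n) (u n - l); rewrite opprB addrC subrK; have := ub n; lra.
Qed.

End real_norm_scalar.

(** * Orthonormal expansions: Cauchy-Schwarz, Bessel, Riesz-Fischer *)

Section basis.
Context {R : realType} {H : completeNormedModType R[i]}.
Context {ip : {dot H for conjC}} (hip : norm_from_dot ip).
Implicit Types (x y z : H) (c d : nat -> R[i]).

Lemma ipC x y : ip x y = conjC (ip y x).
Proof. by rewrite (hermC ip x y) expr0 mul1r. Qed.

Lemma ipDl x y z : ip (x + y) z = ip x z + ip y z.
Proof. exact: linearDl. Qed.

Lemma ipBl x y z : ip (x - y) z = ip x z - ip y z.
Proof. exact: linearBl. Qed.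

Lemma ipZl (a : R[i]) x y : ip (a *: x) y = a * ip x y.
Proof. exact: (linearZl_LR ip y). Qed.

Lemma ip_suml n (f : 'I_n -> H) x : ip (\sum_(k < n) f k) x = \sum_(k < n) ip (f k) x.
Proof. exact: linear_sumlz. Qed.

Lemma ipDr x y z : ip z (x + y) = ip z x + ip z y.
Proof. exact: linearDr. Qed.

Lemma ipZr (a : R[i]) x y : ip x (a *: y) = conjC a * ip x y.
Proof. exact: (linearZr_LR ip x). Qed.

Lemma ip_sumr n (f : 'I_n -> H) x : ip x (\sum_(k < n) f k) = \sum_(k < n) ip x (f k).
Proof. exact: linear_sumr. Qed.

Lemma nr_ip x : ip x x = (nr x ^+ 2)%:C.
Proof. by rewrite hip nrE rmorphXn. Qed.

Lemma nr_pythagoras x y : ip x y = 0 -> nr (x + y) ^+ 2 = nr x ^+ 2 + nr y ^+ 2.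
Proof.
move=> xy; apply: complexI; rewrite rmorphD/= -!nr_ip ipDl !ipDr.
by rewrite xy (ipC y x) xy conjC0 addr0 add0r.
Qed.

(** Cauchy-Schwarz: Pythagoras applied to [x] and its projection [a *: y] on the line of [y]. *)
Lemma nr_ip_le x y : nr (ip x y) <= nr x * nr y.
Proof.
have [->|y0] := eqVneq y 0.
  by rewrite nr0 mulr0 -(scale0r 0) ipZr conjC0 mul0r nr0.
have ny : 0 < nr y.
  rewrite lt_neqAle nr_ge0 andbT eq_sym; apply: contraNneq y0 => /nr_eq0 ->.
  exact: eqxx.
have yy : ip y y != 0 by rewrite nr_ip (inj_eq (@complexI R) _ 0) expf_neq0// gt_eqF.
pose a := ip x y / ip y y.
have o : ip (x - a *: y) (a *: y) = 0.
  by rewrite ipZr ipBl ipZl /a divfK// subrr mulr0.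
have := nr_pythagoras o; rewrite subrK nrZ => e.
have {e} : nr a * nr y <= nr x.
  rewrite -(@ler_sqr R) ?nnegrE ?mulr_ge0 ?nr_ge0//.
  by rewrite [leRHS]e lerDr sqr_ge0.
have -> : ip x y = a * (nr y ^+ 2)%:C by rewrite -nr_ip /a divfK.
move=> h; rewrite [leLHS]nrM nr_real ?sqr_ge0//.
by rewrite expr2 mulrA ler_wpM2r// ltW.
Qed.

Lemma cvg_ip (u : nat -> H) l y : u @ \oo --> l ->
  (fun n => ip (u n) y) @ \oo --> (ip l y : R[i]^o).
Proof.
move=> /cvg_nrP ul; apply/cvg_nrP => e e0.
have y1 : 0 < nr y + 1 by rewrite ltr_wpDl ?nr_ge0.
have [|n0 hn] := ul (e / (nr y + 1)); first by rewrite divr_gt0.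
exists n0 => n /hn; rewrite ler_pdivlMr// => h.
have -> : (ip (u n) y : R[i]^o) - ip l y = ip (u n - l) y by rewrite ipBl.
by have := nr_ip_le (u n - l) y; have := nr_ge0 (u n - l); rewrite /nr/=; nra.
Qed.

Context {E : nat -> H} (hE : orthonormal_basis ip E).

Definition fsum (E : nat -> H) n c : H := \sum_(k < n) c k *: E k.

Lemma ip_basis k l : ip (E k) (E l) = (k == l)%:R.
Proof. by case: hE. Qed.

Lemma nr_basis k : nr (E k) = 1.
Proof.
apply/eqP; rewrite -(@pexpr_eq1 _ _ 2) ?nr_ge0//; apply/eqP.
by apply: complexI; rewrite -nr_ip ip_basis eqxx.
Qed.

Lemma ip_fsum n c k : ip (fsum E n c) (E k) = if (k < n)%N then c k else 0.
Proof.
rewrite /fsum ip_suml; case: ltnP => [kn|nk].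
  rewrite (bigD1 (Ordinal kn))//= big1 ?addr0 => [|j jk].
    by rewrite ipZl ip_basis eqxx mulr1.
  by rewrite ipZl ip_basis -(inj_eq val_inj) /= in jk *; rewrite (negbTE jk) mulr0.
by rewrite big1// => j _; rewrite ipZl ip_basis ltn_eqF ?mulr0// (leq_trans _ nk).
Qed.

Lemma ip_fsumr n c x :
  ip x (fsum E n c) = \sum_(k < n) conjC (c k) * ip x (E k).
Proof. by rewrite /fsum ip_sumr; apply: eq_bigr => k _; rewrite ipZr. Qed.

Lemma nr_fsum n c : nr (fsum E n c) ^+ 2 = \sum_(k < n) nr (c k) ^+ 2.
Proof.
apply: complexI; rewrite -nr_ip ip_fsumr rmorph_sum/=; apply: eq_bigr => k _.
by rewrite ip_fsum ltn_ord mulrC -normCK nrE rmorphXn.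
Qed.

Lemma eq_fsum n c d : (forall k, (k < n)%N -> c k = d k) -> fsum E n c = fsum E n d.
Proof. by move=> cd; apply: eq_bigr => k _; rewrite cd. Qed.

Lemma fsumD n c d : fsum E n (fun k => c k + d k) = fsum E n c + fsum E n d.
Proof. by rewrite /fsum -big_split; apply: eq_bigr => k _; rewrite scalerDl. Qed.

Lemma fsumZ n a c : fsum E n (fun k => a * c k) = a *: fsum E n c.
Proof. by rewrite /fsum scaler_sumr; apply: eq_bigr => k _; rewrite scalerA. Qed.

Lemma fsumB n c d : fsum E n (fun k => c k - d k) = fsum E n c - fsum E n d.
Proof.
rewrite -scaleN1r -fsumZ -fsumD; apply: eq_fsum => k _; by rewrite mulN1r.
Qed.

Lemma fsum_widen n m c : (n <= m)%N ->
  fsum E m (fun k => if (k < n)%N then c k else 0) = fsum E n c.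
Proof.
move=> nm; rewrite /fsum (big_ord_widen m (fun k => c k *: E k) nm) [RHS]big_mkcond.
by apply: eq_bigr => k _; case: ifP => // _; rewrite scale0r.
Qed.

Lemma ler_nr_fsum n c d : (forall k, (k < n)%N -> nr (c k) <= nr (d k)) ->
  nr (fsum E n c) <= nr (fsum E n d).
Proof.
move=> cd; rewrite -(@ler_sqr R) ?nnegrE ?nr_ge0// !nr_fsum.
by apply: ler_sum => k _; rewrite ler_sqr ?nnegrE ?nr_ge0// cd.
Qed.

Lemma nr_fsum_mono n m c : (n <= m)%N -> nr (fsum E n c) <= nr (fsum E m c).
Proof.
move=> nm; rewrite -(fsum_widen c nm); apply: ler_nr_fsum => k _.
by case: ifP => // _; rewrite nr0 nr_ge0.
Qed.

Lemma nr_fsum_diff n m c : (n <= m)%N ->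
  nr (fsum E m c - fsum E n c) ^+ 2 = nr (fsum E m c) ^+ 2 - nr (fsum E n c) ^+ 2.
Proof.
move=> nm; rewrite -(fsum_widen c nm) -fsumB !nr_fsum -sumrB; apply: eq_bigr => k _.
by case: ifP => _; rewrite ?subrr ?subr0 nr0 expr0n/= ?subr0.
Qed.

(** The squared norms of the partial sums increase and are bounded, hence come within [e ^+ 2] of
    their supremum; by orthogonality the squared distance of two partial sums is the difference of
    their squared norms. *)
Lemma riesz_fischer c (b : R) : (forall n, nr (fsum E n c) <= b) ->
  cvgn (fun n => fsum E n c).
Proof.
move=> hb; apply: cvg_nr_cauchy => e e0.
pose S : set R := range (fun n => nr (fsum E n c) ^+ 2).
have Ssup : has_sup S.
  split; first by exists (nr (fsum E 0 c) ^+ 2), 0%N.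
  exists (b ^+ 2) => _ [n _ <-]; rewrite ler_sqr ?nnegrE ?nr_ge0//.
  exact: le_trans (nr_ge0 _) (hb n).
have e2 : 0 < e ^+ 2 by rewrite exprn_gt0.
have [_ [n0 _ <-] hn0] := sup_adherent e2 Ssup.
exists n0 => n n0n; rewrite -(@ler_sqr R) ?nnegrE ?nr_ge0 ?(ltW e0)//.
rewrite nr_fsum_diff//.
have : nr (fsum E n c) ^+ 2 <= sup S by apply: ub_le_sup; [case: Ssup|exists n].
by move: hn0; lra.
Qed.

Definition basis_proj (ip : {dot H for conjC}) (E : nat -> H) n x :=
  fsum E n (fun k => ip x (E k)).
Local Notation proj := (basis_proj ip E).

Lemma projB n x y : proj n (x - y) = proj n x - proj n y.
Proof. by rewrite /basis_proj -fsumB; apply: eq_fsum => k _; rewrite ipBl. Qed.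

(** Bessel's inequality: the remainder [x - proj n x] is orthogonal to the projection. *)
Lemma nr_proj n x : nr (proj n x) <= nr x.
Proof.
have o : ip (x - proj n x) (proj n x) = 0.
  rewrite {2}/basis_proj ip_fsumr big1// => k _.
  by rewrite ipBl ip_fsum ltn_ord subrr mulr0.
have := nr_pythagoras o; rewrite subrK => h.
by rewrite -(@ler_sqr R) ?nnegrE ?nr_ge0// [leRHS]h lerDr sqr_ge0.
Qed.

Lemma proj_fsum n m c : (n <= m)%N -> proj m (fsum E n c) = fsum E n c.
Proof.
by move=> nm; rewrite -(fsum_widen c nm); apply: eq_fsum => k km; rewrite ip_fsum km.
Qed.

Lemma fsum_dense x (e : R) : 0 < e -> exists n c, nr (x - fsum E n c) < e.
Proof.
move=> e0; have e0C : 0 < e%:C by rewrite ltcR.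
have [_ hd] := hE; have [|y []] := hd _ _ (open_interior (ball x e%:C)).
  by exists x; apply: nbhsx_ballx.
move=> /interior_subset + [n [c yE]]; rewrite -ball_normE/= nrE ltcR => h.
by exists n, c; rewrite -[fsum _ _ _]yE.
Qed.

(** A finite combination close to [x] is fixed by all later projections, and projections do not
    increase distances. *)
Lemma cvg_proj x : (fun n => proj n x) @ \oo --> x.
Proof.
apply/cvg_nrP => e e0; have [|n [c h]] := @fsum_dense x (e / 2).
  by rewrite divr_gt0.
exists n => m nm; apply: le_trans (nr_tri _ (fsum E n c) _) _.
rewrite -{1}(proj_fsum c nm) -projB [nr (_ - x)]nr_distC.
by have := nr_proj m (x - fsum E n c); lra.
Qed.

Lemma ip_basis_inj x y : (forall k, ip x (E k) = ip y (E k)) -> x = y.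
Proof.
move=> xy; rewrite -(cvg_lim (@norm_hausdorff _ H) (@cvg_proj x)).
rewrite -(cvg_lim (@norm_hausdorff _ H) (@cvg_proj y)); congr (lim (_ @ \oo)).
by apply/funext => n; apply: eq_fsum => k _.
Qed.

End basis.

Arguments cvg_proj {R H ip} hip {E} hE x [t] _.

(** * Bounded operators and their finite sections *)

Section operators.
Context {R : realType} {H : completeNormedModType R[i]}.
Context {ip : {dot H for conjC}} (hip : norm_from_dot ip).
Context {E : nat -> H} (hE : orthonormal_basis ip E).
Implicit Types (x y z : H) (S T : H -> H) (m : nat -> nat -> R[i]) (C : R).

Lemma linear_fun0 T : linear T -> T 0 = 0.
Proof.
move=> L; have /eqP := L 1 0 0; rewrite !scale1r addr0.
by rewrite -subr_eq0 opprD addNKr oppr_eq0 => /eqP.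
Qed.

Lemma linear_funZ T a x : linear T -> T (a *: x) = a *: T x.
Proof. by move=> L; rewrite -[a *: x]addr0 L linear_fun0// addr0. Qed.

Lemma linear_funD T x y : linear T -> T (x + y) = T x + T y.
Proof. by move=> L; have := L 1 x y; rewrite !scale1r. Qed.

Lemma linear_funB T x y : linear T -> T (x - y) = T x - T y.
Proof. by move=> L; rewrite addrC -scaleN1r L scaleN1r addrC. Qed.

Lemma linear_fsum T n c : linear T -> T (fsum E n c) = \sum_(k < n) c k *: T (E k).
Proof.
move=> L; rewrite /fsum; elim: n => [|n IH]; first by rewrite !big_ord0 linear_fun0.
by rewrite !big_ord_recr/= linear_funD// IH linear_funZ.
Qed.

Lemma bounded_nr T : bounded_operator T ->
  linear T /\ exists2 C, 0 <= C & forall x, nr (T x) <= C * nr x.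
Proof.
move=> [L [C TC]]; split=> //; exists (nr C); first exact: nr_ge0.
move=> x; rewrite -lecR rmorphM/= -!nrE.
apply: le_trans (TC x) _; rewrite -[leLHS]ger0_norm ?normrM ?normr_id//.
exact: le_trans (normr_ge0 _) (TC x).
Qed.

Lemma nr_bounded T C : linear T -> (forall x, nr (T x) <= C * nr x) ->
  bounded_operator T.
Proof. by move=> L TC; split=> //; exists C%:C => x; rewrite !nrE -rmorphM lecR. Qed.

Lemma cvg_bounded_operator T (u : nat -> H) l : bounded_operator T ->
  u @ \oo --> l -> (fun n => T (u n)) @ \oo --> T l.
Proof.
move=> /bounded_nr[L [C C0 TC]] /cvg_nrP ul; apply/cvg_nrP => e e0.
have C1 : 0 < C + 1 by lra.
have [|n0 hn] := ul (e / (C + 1)); first by rewrite divr_gt0.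
exists n0 => n /hn; rewrite ler_pdivlMr// -linear_funB// => h.
by apply: le_trans (TC _) _; have := nr_ge0 (u n - l); nra.
Qed.

Lemma opnorm_leP T C : linear T ->
  (opnorm T <= C%:E)%E <-> forall x, nr (T x) <= C * nr x.
Proof.
move=> L; split=> [TC x|TC].
  have [->|x0] := eqVneq x 0; first by rewrite linear_fun0// !nr0 mulr0.
  have nx : 0 < nr x.
    rewrite lt_neqAle nr_ge0 andbT eq_sym; apply: contraNneq x0 => /nr_eq0 ->.
    exact: eqxx.
  have nV : nr ((nr x)^-1%:C *: x) = 1.
    by rewrite nrZ nr_real ?invr_ge0 ?(ltW nx)// mulVf// gt_eqF.
  have : ((nr (T ((nr x)^-1%:C *: x)))%:E <= C%:E)%E.
    apply: le_trans TC; apply: ereal_sup_ubound => /=.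
    by exists ((nr x)^-1%:C *: x) => //; rewrite nrE nV.
  rewrite lee_fin linear_funZ// nrZ nr_real ?invr_ge0 ?(ltW nx)//.
  by rewrite mulrC ler_pdivrMr.
(* The unit vector [E 0] shows that [C] is nonnegative, which is what turns [C * nr x] into a
   quantity at most [C] on the unit ball. *)
have C0 : 0 <= C.
  by have := TC (E 0); rewrite (nr_basis hip hE) mulr1; apply: le_trans; exact: nr_ge0.
apply: ub_ereal_sup => _ [x /= x1 <-]; rewrite lee_fin.
by apply: le_trans (TC x) _; rewrite ler_piMr// -lecR -nrE.
Qed.

Lemma opnorm_ge0 T : (0 <= opnorm T)%E.
Proof.
apply: ereal_sup_ge; exists (nr (T 0))%:E; last by rewrite lee_fin nr_ge0.
by exists 0 => //=; rewrite normr0.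
Qed.

Lemma bounded_coef_inj S T : bounded_operator S -> bounded_operator T ->
  (forall k l, mxcoef ip E S k l = mxcoef ip E T k l) -> S = T.
Proof.
move=> bS bT ST; apply/funext => x.
have SE l : S (E l) = T (E l) by apply: (ip_basis_inj hip hE) => k; exact: ST.
rewrite -(cvg_lim (@norm_hausdorff _ H) (cvg_bounded_operator bS (cvg_proj hip hE x))).
rewrite -(cvg_lim (@norm_hausdorff _ H) (cvg_bounded_operator bT (cvg_proj hip hE x))).
congr (lim (_ @ \oo)); apply/funext => n; rewrite /basis_proj.
rewrite !linear_fsum; [|by case: bT|by case: bS].
by apply: eq_bigr => k _; rewrite SE.
Qed.

Definition mxapply m n (c : nat -> R[i]) : nat -> R[i] :=
  fun k => \sum_(l < n) m k l * c l.

Definition mxbound m C : Prop :=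
  forall n c, nr (fsum E n (mxapply m n c)) <= C * nr (fsum E n c).

Lemma mxbound_ge0 m C : mxbound m C -> 0 <= C.
Proof.
move=> /(_ 1%N (fun=> 1)); rewrite {2}/fsum big_ord1 scale1r (nr_basis hip hE) mulr1.
by apply: le_trans; exact: nr_ge0.
Qed.

(** A column is the image of a basis vector. The section is enlarged to [n + l.+1] so that it
    contains both the first [n] rows and the column [l]. *)
Lemma mxbound_col m C l n : mxbound m C -> nr (fsum E n (m^~ l)) <= C.
Proof.
move=> hm; apply: (@le_trans _ _ (nr (fsum E (n + l.+1) (m^~ l)))).
  by apply: (nr_fsum_mono hip hE); exact: leq_addr.
have ll : (l < n + l.+1)%N by rewrite addnS ltnS leq_addl.
have := hm (n + l.+1)%N (fun k => (k == l)%:R).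
rewrite [X in nr X](_ : _ = fsum E (n + l.+1) (m^~ l)); last first.
  apply: eq_fsum => k _; rewrite /mxapply (bigD1 (Ordinal ll))//= eqxx mulr1.
  rewrite big1 ?addr0// => j; rewrite -(inj_eq val_inj)/= => /negbTE ->.
  by rewrite mulr0.
rewrite [X in C * nr X](_ : _ = E l) ?(nr_basis hip hE) ?mulr1//.
rewrite /fsum (bigD1 (Ordinal ll))//= eqxx scale1r.
rewrite big1 ?addr0// => j; rewrite -(inj_eq val_inj)/= => /negbTE ->.
by rewrite scale0r.
Qed.

Lemma mxbound_coef m C k l : mxbound m C -> nr (m k l) <= C.
Proof.
move=> hm; apply: le_trans (mxbound_col l k.+1 hm).
have {1}-> : m k l = ip (fsum E k.+1 (m^~ l)) (E k) by rewrite (ip_fsum hE) ltnSn.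
by apply: le_trans (nr_ip_le hip _ _) _; rewrite (nr_basis hip hE) mulr1.
Qed.

Lemma bounded_mxbound T C : linear T -> (forall x, nr (T x) <= C * nr x) ->
  mxbound (mxcoef ip E T) C.
Proof.
move=> L TC n c; apply: le_trans (TC _).
rewrite (_ : fsum E n _ = basis_proj ip E n (T (fsum E n c))).
  exact: (nr_proj hip hE).
apply: eq_fsum => k _; rewrite linear_fsum// ip_suml; apply: eq_bigr => l _.
by rewrite ipZl mulrC.
Qed.

(** The operator is the pointwise limit of the section operators [Tn]. On [E l] these give partial
    sums of a column, convergent by Riesz-Fischer; the common bound [C] and the density of finite
    combinations extend the convergence to all of [H]. *)
Lemma mxbound_operator m C : mxbound m C -> exists T,
  [/\ linear T, forall x, nr (T x) <= C * nr x &
      forall k l, mxcoef ip E T k l = m k l].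
Proof.
move=> hm; have C0 := mxbound_ge0 hm.
pose Tn n x := fsum E n (mxapply m n (fun l => ip x (E l))).
have TnL n : linear (Tn n).
  move=> a x y; rewrite /Tn -fsumZ -fsumD; apply: eq_fsum => k _.
  rewrite /mxapply mulr_sumr -big_split; apply: eq_bigr => l _.
  by rewrite ipDl ipZl/=; ring.
have TnC n x : nr (Tn n x) <= C * nr x.
  apply: le_trans (hm _ _) _; apply: ler_wpM2l => //; exact: (nr_proj hip hE).
have TnE n l : (l < n)%N -> Tn n (E l) = fsum E n (m^~ l).
  move=> ln; apply: eq_fsum => k _; rewrite /mxapply (bigD1 (Ordinal ln))//=.
  rewrite (ip_basis hE) eqxx mulr1 big1 ?addr0// => j.
  by rewrite -(inj_eq val_inj)/= (ip_basis hE) eq_sym => /negbTE ->; rewrite mulr0.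
have col l : (fun n => Tn n (E l)) @ \oo --> lim (fsum E n (m^~ l) @[n --> \oo]).
  apply: cvg_trans (riesz_fischer hip hE (fun n => mxbound_col l n hm)).
  by apply: near_eq_cvg; exists l.+1 => // n /= ln; rewrite TnE.
have cvT x : cvgn (fun n => Tn n x).
  apply: cvg_nr_cauchy => e e0.
  (* Approximating [x] within [e / (4 * (C + 1))] costs at most [e / 4] after [Tn]; convergence on
     the approximant costs another [e / 4], and two indices are compared through [y]. *)
  have C1 : 0 < 4 * (C + 1) by lra.
  have [|p [c hx]] := fsum_dense hE x (e := e / (4 * (C + 1))).
    by rewrite divr_gt0.
  have : cvgn (fun n => Tn n (fsum E p c)).
    rewrite (_ : (fun n => _) = (fun n => \sum_(k < p) c k *: Tn n (E k))).
      elim: p {hx} => [|p IH].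
        by under eq_fun do rewrite big_ord0; exact: is_cvg_cst.
      under eq_fun do rewrite big_ord_recr/=.
      apply: (is_cvgD IH); apply: is_cvgZl_tmp.
      by apply/cvg_ex; eexists; exact: col.
    by apply/funext => n; rewrite linear_fsum.
  move=> /cvg_ex[y /cvg_nrP yP].
  have [|n0 hn0] := yP (e / 4); first by rewrite divr_gt0.
  exists n0 => n n0n.
  have h1 j : (n0 <= j)%N -> nr (Tn j x - y) <= e / 2.
    move=> n0j; apply: le_trans (nr_tri _ (Tn j (fsum E p c)) _) _.
    rewrite -linear_funB//.
    have := hn0 _ n0j; have := TnC j (x - fsum E p c).
    move: hx; rewrite ltr_pdivlMr//.
    by have := nr_ge0 (x - fsum E p c); nra.
  apply: le_trans (nr_tri _ y _) _.
  by have := h1 _ n0n; have := h1 _ (leqnn _); rewrite (nr_distC (Tn n0 x)); lra.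
exists (fun x => lim (Tn n x @[n --> \oo])); split.
- move=> a x y; apply: (cvg_lim (@norm_hausdorff _ H)).
  rewrite (_ : (fun n => _) = (fun n => a *: Tn n x + Tn n y)).
    by apply: cvgD; [apply: cvgZl_tmp; exact: cvT|exact: cvT].
  by apply/funext => n; rewrite TnL.
- by move=> x; apply: cvg_nr_le (cvT x) _.
- move=> k l; rewrite /mxcoef.
  have h := cvg_ip hip (y := E k) (cvT (E l)).
  have h' : (fun n => ip (Tn n (E l)) (E k)) @ \oo --> (m k l : R[i]^o).
    apply: cvg_near_cst; exists (maxn k l).+1 => // n /=.
    by rewrite gtn_max => /andP[kn ln]; rewrite TnE// (ip_fsum hE) kn.
  have hd : hausdorff_space R[i]^o := @norm_hausdorff _ _.
  by rewrite -(cvg_lim hd h) (cvg_lim hd h').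
Qed.

(** The set under the infimum is either a singleton, since coefficients determine a bounded
    operator, or empty, in which case the infimum is [+oo] and no real bound holds. *)
Lemma mxopnorm_leP m C : (mxopnorm ip E m <= C%:E)%E <-> mxbound m C.
Proof.
split=> [|/mxbound_operator[T [L TC Tm]]]; last first.
  apply: (@le_trans _ _ (opnorm T)); last exact/opnorm_leP.
  apply: ereal_inf_lbound; exists T => //; split=> //; exact: nr_bounded TC.
rewrite /mxopnorm; set A := [set T | _].
have [[T [bT Tm]]|] := pselect (exists T, A T).
  rewrite (_ : @opnorm R H @` A = [set opnorm T]).
    have /bounded_nr [L _] := bT.
    rewrite ereal_inf1 => /(opnorm_leP _ L) TC.
    have := bounded_mxbound L TC; rewrite (_ : mxcoef _ _ _ = m)//.
    by apply/funext => k; apply/funext => l; exact: Tm.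
  apply/seteqP; split=> [_ [S [bS Sm] <-]|_ ->]; last by exists T.
  by rewrite /= (bounded_coef_inj bS bT)// => k l; rewrite Sm Tm.
move=> A0; rewrite (_ : A = set0) ?image_set0 ?ereal_inf0 ?leye_eq//.
by rewrite -subset0 => T AT; apply: A0; exists T.
Qed.

Lemma mxopnorm_ge0 m : (0 <= mxopnorm ip E m)%E.
Proof. by apply: le_ereal_inf_tmp => _ [T _ <-]; exact: opnorm_ge0. Qed.

Lemma mxopnorm_finite m : (mxopnorm ip E m < +oo)%E ->
  exists2 C, mxopnorm ip E m = C%:E & mxbound m C.
Proof.
move=> h; have f : mxopnorm ip E m = (fine (mxopnorm ip E m))%:E.
  by rewrite fineK// ge0_fin_numE ?mxopnorm_ge0.
by exists (fine (mxopnorm ip E m)) => //; apply/mxopnorm_leP; rewrite -f.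
Qed.

End operators.

Lemma nr_1nat (R : realType) n : nr (1 + n%:R : R[i]) = 1 + n%:R.
Proof. by rewrite addrC natr1 nr_nat -natr1 addrC. Qed.

(** * Calculus of the matrix norms, and rapid decay *)

Section matrix_norms.
Context {R : realType} {H : completeNormedModType R[i]}.
Context {ip : {dot H for conjC}} (hip : norm_from_dot ip).
Context {E : nat -> H} (hE : orthonormal_basis ip E).
Implicit Types (m : nat -> nat -> R[i]) (C : R).

Local Notation mxopnorm := (mxopnorm ip E).
Local Notation mxnorm := (mxnorm ip E).
Local Notation mxnorm0 := (mxnorm0 ip E).
Local Notation mxbound := (@mxbound R H E).

(** Reduces comparisons in the extended reals to real bounds: an infinite right-hand side is
    trivial. *)
Lemma le_mxopnorm m m' : (forall C, mxbound m C -> mxbound m' C) ->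
  (mxopnorm m' <= mxopnorm m)%E.
Proof.
move=> h; have [moo|] := ltP (mxopnorm m) +oo%E; last first.
  by rewrite leye_eq => /eqP ->; rewrite leey.
have [C -> mC] := mxopnorm_finite hip hE moo.
exact/(mxopnorm_leP hip hE)/h.
Qed.

Lemma mxboundD m1 m2 C1 C2 : mxbound m1 C1 -> mxbound m2 C2 ->
  mxbound (fun k l => m1 k l + m2 k l) (C1 + C2).
Proof.
move=> h1 h2 n c; rewrite (_ : fsum E n _ =
    fsum E n (mxapply m1 n c) + fsum E n (mxapply m2 n c)).
  by apply: le_trans (nrD _ _) _; rewrite mulrDl lerD.
rewrite -fsumD; apply: eq_fsum => k _; rewrite /mxapply -big_split/=.
by apply: eq_bigr => l _; rewrite mulrDl.
Qed.

Lemma mxboundZ (a : R[i]) m C : mxbound m C ->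
  mxbound (fun k l => a * m k l) (nr a * C).
Proof.
move=> h n c; rewrite (_ : fsum E n _ = a *: fsum E n (mxapply m n c)).
  by rewrite nrZ -mulrA ler_wpM2l ?nr_ge0.
rewrite -fsumZ; apply: eq_fsum => k _; rewrite /mxapply mulr_sumr.
by apply: eq_bigr => l _; rewrite mulrA.
Qed.

(** A diagonal factor on the column side can be moved onto the vector, whose norm it does not
    increase. *)
Lemma mxbound_diagr (d : nat -> R[i]) m C : (forall l, nr (d l) <= 1) ->
  mxbound m C -> mxbound (fun k l => d l * m k l) C.
Proof.
move=> d1 h n c; have C0 := mxbound_ge0 hip hE h.
rewrite (_ : fsum E n _ = fsum E n (mxapply m n (fun l => d l * c l))).
  apply: le_trans (h _ _) _; apply: ler_wpM2l => //.
  apply: (ler_nr_fsum hip hE) => l _; rewrite nrM ler_piMl ?nr_ge0//.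
apply: eq_fsum => k _; apply: eq_bigr => l _; ring.
Qed.

(** With [z] the image of [c] under the adjoint section, the squared norm of [z] is the product of
    [c] with the image of [z] under the section of [m]. Cauchy-Schwarz and the bound [C] then allow
    one norm of [z] to be cancelled. *)
Lemma mxbound_adj m C : mxbound m C -> mxbound (fun k l => conjC (m l k)) C.
Proof.
move=> h n c; set z := mxapply _ _ _; have C0 := mxbound_ge0 hip hE h.
have e : ip (fsum E n z) (fsum E n z) = ip (fsum E n c) (fsum E n (mxapply m n z)).
  rewrite !(ip_fsumr) /=.
  under eq_bigr => k _ do rewrite (ip_fsum hE) ltn_ord {2}/z mulr_sumr.
  under [RHS]eq_bigr => k _ do
    rewrite (ip_fsum hE) ltn_ord /mxapply rmorph_sum/= mulr_suml.
  rewrite exchange_big/=; apply: eq_bigr => l _; apply: eq_bigr => k _.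
  by rewrite rmorphM/=; ring.
have le : nr (fsum E n z) ^+ 2 <= nr (fsum E n c) * (C * nr (fsum E n z)).
  rewrite -(@nr_real R (nr (fsum E n z) ^+ 2)) ?sqr_ge0// -(nr_ip hip) e.
  apply: le_trans (nr_ip_le hip _ _) _; apply: ler_wpM2l; first exact: nr_ge0.
  exact: h.
have [z0|z0] := eqVneq (nr (fsum E n z)) 0.
  by rewrite z0 mulr_ge0 ?nr_ge0.
have zp : 0 < nr (fsum E n z) by rewrite lt_neqAle eq_sym z0 nr_ge0.
by move: le; rewrite expr2 mulrA ler_pM2r// mulrC.
Qed.

Lemma mxopnormD m1 m2 :
  (mxopnorm (fun k l => m1 k l + m2 k l)%R <= mxopnorm m1 + mxopnorm m2)%E.
Proof.
have [m1oo|] := ltP (mxopnorm m1) +oo%E; last first.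
  rewrite leye_eq => /eqP ->; rewrite addye ?leey//.
  by rewrite gt_eqF// (lt_le_trans _ (mxopnorm_ge0 _)) ?ltNy0.
have [m2oo|] := ltP (mxopnorm m2) +oo%E; last first.
  rewrite leye_eq => /eqP ->; rewrite addey ?leey//.
  by rewrite gt_eqF// (lt_le_trans _ (mxopnorm_ge0 _)) ?ltNy0.
have [C1 -> b1] := mxopnorm_finite hip hE m1oo.
have [C2 -> b2] := mxopnorm_finite hip hE m2oo.
by rewrite -EFinD; apply/(mxopnorm_leP hip hE); exact: mxboundD.
Qed.

Lemma mxopnormZ (a : R[i]) m : (mxopnorm m < +oo)%E ->
  (mxopnorm (fun k l => a * m k l)%R <= (nr a)%:E * mxopnorm m)%E.
Proof.
move=> /(mxopnorm_finite hip hE)[C -> mC].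
by rewrite -EFinM; apply/(mxopnorm_leP hip hE); exact: mxboundZ.
Qed.

Lemma mxdelta_add i j m : mxdelta i (mxdelta j m) = mxdelta (j + i) m.
Proof.
by apply/funext => k; apply/funext => l; rewrite /mxdelta exprD; ring.
Qed.

Lemma mxnorm0_ge0 N m : (0 <= mxnorm0 N m)%E.
Proof. exact: mxopnorm_ge0. Qed.

Lemma mxnorm_ge0 M N m : (0 <= mxnorm M N m)%E.
Proof.
by apply: sume_ge0 => j _; rewrite mule_ge0 ?mxnorm0_ge0// lee_fin ler0n.
Qed.

Lemma mxnorm_0 N m : mxnorm 0 N m = mxnorm0 N m.
Proof.
rewrite /Defs.mxnorm big_ord1 bin0 mul1e; congr mxnorm0.
by apply/funext => k; apply/funext => l; rewrite /mxdelta expr0 mul1r.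
Qed.

(** Pascal's rule on the weights; the extra last term vanishes because ['C(M, M.+1)] is zero. *)
Lemma mxnormS M N m :
  (mxnorm M.+1 N m = mxnorm M N m + mxnorm M N (mxdelta 1 m))%E.
Proof.
rewrite /Defs.mxnorm; under [X in (_ + X)%E]eq_bigr do rewrite mxdelta_add add1n.
set f := fun j => mxnorm0 N (mxdelta j m).
have f0 j : (0 <= f j)%E by exact: mxnorm0_ge0.
rewrite big_ord_recl/= bin0 mul1e.
under eq_bigr => j _.
  rewrite /bump/= add1n binS natrD EFinD ge0_muleDl ?lee_fin ?ler0n//; over.
rewrite big_split/= addeA; congr (_ + _)%E.
rewrite big_ord_recr/= bin_small// mul0e adde0.
by rewrite [RHS]big_ord_recl/= bin0 mul1e.
Qed.

Lemma mxnorm_delta_le M N m : (mxnorm M N (mxdelta 1 m) <= mxnorm M.+1 N m)%E.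
Proof. by rewrite mxnormS leeDr// mxnorm_ge0. Qed.

Lemma mxnorm_leS M N m : (mxnorm M N m <= mxnorm M.+1 N m)%E.
Proof. by rewrite mxnormS leeDl// mxnorm_ge0. Qed.

(** The lower weight is the higher one times the diagonal contraction [(1 + l)^-1]. *)
Lemma mxnorm0_leS N m : (mxnorm0 N m <= mxnorm0 N.+1 m)%E.
Proof.
apply: le_mxopnorm => C.
have -> : (fun k l => (1 + l%:R) ^+ N * m k l) =
    (fun k l => (1 + l%:R)^-1 * ((1 + l%:R) ^+ N.+1 * m k l)).
  by apply/funext => k; apply/funext => l; rewrite exprS !mulrA mulVf ?mul1r//.
apply: mxbound_diagr => l.
have e : nr ((1 + l%:R : R[i])^-1) * (1 + l%:R) = 1.
  by rewrite -nr_1nat -nrM mulVf ?(@nr_nat R 1)// addrC natr1 pnatr_eq0.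
by have := nr_ge0 ((1 + l%:R : R[i])^-1); have := ler0n R l; nra.
Qed.

Lemma mxnorm_le M M' N N' m : (M <= M')%N -> (N <= N')%N ->
  (mxnorm M N m <= mxnorm M' N' m)%E.
Proof.
move=> MM NN; apply: (@le_trans _ _ (mxnorm M' N m)).
  elim: M' MM => [|M' IH]; first by rewrite leqn0 => /eqP ->.
  rewrite leq_eqVlt => /predU1P[->//|]; rewrite ltnS => /IH h.
  exact: le_trans h (mxnorm_leS _ _ _).
apply: lee_sum => j _; apply: lee_wpmul2l; first by rewrite lee_fin ler0n.
elim: N' NN => [|N' IH]; first by rewrite leqn0 => /eqP ->.
rewrite leq_eqVlt => /predU1P[->//|]; rewrite ltnS => /IH h.
exact: le_trans h (mxnorm0_leS _ _).
Qed.

Lemma mxnormD M N m1 m2 :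
  (mxnorm M N (fun k l => m1 k l + m2 k l)%R <= mxnorm M N m1 + mxnorm M N m2)%E.
Proof.
elim: M m1 m2 => [|M IH] m1 m2.
  rewrite !mxnorm_0; apply: le_trans (mxopnormD _ _); rewrite le_eqVlt; apply/orP.
  left; apply/eqP; congr mxopnorm.
  by apply/funext => k; apply/funext => l; rewrite mulrDr.
rewrite !mxnormS addeACA; apply: leeD => //; apply: le_trans (IH _ _).
rewrite le_eqVlt; apply/orP; left; apply/eqP; congr mxnorm.
by apply/funext => k; apply/funext => l; rewrite /mxdelta mulrDr.
Qed.

Lemma mxnormZ M N (a : R[i]) m : (mxnorm M N m < +oo)%E ->
  (mxnorm M N (fun k l => a * m k l)%R <= (nr a)%:E * mxnorm M N m)%E.
Proof.
elim: M m => [|M IH] m.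
  rewrite !mxnorm_0 => /mxopnormZ - /(_ a); apply: le_trans.
  rewrite le_eqVlt; apply/orP; left; apply/eqP; congr mxopnorm.
  by apply/funext => k; apply/funext => l; rewrite mulrCA.
move=> h; rewrite !mxnormS ge0_muleDr ?mxnorm_ge0//; apply: leeD.
  by apply: IH; exact: le_lt_trans (mxnorm_leS _ _ _) h.
rewrite (_ : mxdelta 1 _ = fun k l => a * mxdelta 1 m k l).
  by apply: IH; exact: le_lt_trans (mxnorm_delta_le _ _ _) h.
by apply/funext => k; apply/funext => l; rewrite /mxdelta mulrCA.
Qed.

Lemma mxnormN M N m : (mxnorm M N (fun k l => - m k l)%R = mxnorm M N m)%E.
Proof.
have le m' : (mxnorm M N (fun k l => - m' k l)%R <= mxnorm M N m')%E.
  have [h|] := ltP (mxnorm M N m') +oo%E; last first.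
    by rewrite leye_eq => /eqP ->; rewrite leey.
  have := mxnormZ (-1) h; rewrite nrN (@nr_nat R 1) mul1e; apply: le_trans.
  rewrite le_eqVlt; apply/orP; left; apply/eqP; congr mxnorm.
  by apply/funext => k; apply/funext => l; rewrite mulN1r.
apply/eqP; rewrite eq_le le/=; apply: le_trans (le _).
rewrite le_eqVlt; apply/orP; left; apply/eqP; congr mxnorm.
by apply/funext => k; apply/funext => l; rewrite opprK.
Qed.

(* Expands [1 + k = (1 + l) + (k - l)] repeatedly to move the weights from the
   row index to the column index. *)
Lemma mxopnorm_row_weight r s m :
  (mxopnorm (fun k l => (1 + k%:R) ^+ r * ((1 + l%:R) ^+ s * m k l))%R <=
   mxnorm r (r + s) m)%E.
Proof.
elim: r s m => [|r IH] s m.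
  rewrite mxnorm_0 le_eqVlt; apply/orP; left; apply/eqP; congr mxopnorm.
  by apply/funext => k; apply/funext => l; rewrite expr0 mul1r.
apply: le_trans (_ : mxnorm r (r + s.+1) m + mxnorm r (r + s) (mxdelta 1 m) <= _)%E.
  apply: le_trans (leeD (IH _ _) (IH _ _)); apply: le_trans (mxopnormD _ _).
  rewrite le_eqVlt; apply/orP; left; apply/eqP; congr mxopnorm.
  by apply/funext => k; apply/funext => l; rewrite /mxdelta expr1 !exprS; ring.
by rewrite mxnormS addnS addSn leeD2l// mxnorm_le.
Qed.

(** The adjoint turns the column weight of order [N] into a row weight; moving it back costs up to
    [N] commutators, whence the index [M + N]. The sign produced by each further commutator does not
    change the norm. *)
Lemma mxnorm_adj M N m :
  (mxnorm M N (fun k l => conjC (m l k)) <= mxnorm (M + N) N m)%E.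
Proof.
elim: M m => [|M IH] m.
  rewrite mxnorm_0 add0n; have := mxopnorm_row_weight N 0 m; rewrite addn0.
  apply: le_trans; apply: le_mxopnorm => C /mxbound_adj.
  rewrite [X in mxbound X _](_ : _ = (fun k l => (1 + l%:R) ^+ N * conjC (m l k)))//.
  apply/funext => k; apply/funext => l.
  by rewrite expr0 mul1r rmorphM rmorphXn rmorphD/= conjC1 conjC_nat.
rewrite addSn !mxnormS; apply: leeD => //.
rewrite -mxnormN; apply: le_trans (IH (mxdelta 1 m)).
rewrite le_eqVlt; apply/orP; left; apply/eqP; congr mxnorm.
apply/funext => k; apply/funext => l.
by rewrite /mxdelta !expr1 rmorphM rmorphB/= !conjC_nat; ring.
Qed.

(** Each operator norm dominates the entries of its matrix, and the binomial weights sum the powers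
    of [nr (k - l)] to a power of [1 + nr (k - l)]; the induction performs this summation through
    [mxnormS]. *)
Lemma mxnorm_coef M N m C k l : (mxnorm M N m <= C%:E)%E ->
  (1 + nr (k%:R - l%:R : R[i])) ^+ M * (1 + l%:R) ^+ N * nr (m k l) <= C.
Proof.
elim: M m C => [|M IH] m C.
  rewrite mxnorm_0 => /(mxopnorm_leP hip hE)/(mxbound_coef hip hE k l).
  by rewrite nrM nrX nr_1nat expr0 mul1r.
move=> h.
have f1 : mxnorm M N m \is a fin_num.
  rewrite ge0_fin_numE ?mxnorm_ge0//; apply: le_lt_trans (mxnorm_leS _ _ _) _.
  by apply: le_lt_trans h _; rewrite ltry.
have f2 : mxnorm M N (mxdelta 1 m) \is a fin_num.
  rewrite ge0_fin_numE ?mxnorm_ge0//; apply: le_lt_trans (mxnorm_delta_le _ _ _) _.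
  by apply: le_lt_trans h _; rewrite ltry.
move: h; rewrite mxnormS -(fineK f1) -(fineK f2) -EFinD lee_fin; apply: le_trans.
have h1 := IH m (fine (mxnorm M N m)).
have h2 := IH (mxdelta 1 m) (fine (mxnorm M N (mxdelta 1 m))).
rewrite !fineK ?lexx// in h1 h2.
apply: le_trans (lerD (h1 isT) (h2 isT)).
by rewrite /mxdelta expr1 nrM exprS le_eqVlt; apply/orP; left; apply/eqP; ring.
Qed.

Lemma rapid_decay_nr (c : nat -> nat -> R[i]) : rapid_decay c <->
  forall M N : nat, exists B : R, forall k l : nat,
    (1 + k%:R) ^+ M * (1 + l%:R) ^+ N * nr (c k l) <= B.
Proof.
have e M N k l : (1 + k%:R) ^+ M * (1 + l%:R) ^+ N * `|c k l| =
    ((1 + k%:R) ^+ M * (1 + l%:R) ^+ N * nr (c k l))%:C.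
  by rewrite nrE !rmorphM !rmorphXn !rmorphD/= !rmorph1 !rmorph_nat.
split=> h M N; have [B hB] := h M N; last first.
  by exists B%:C => k l; rewrite e lecR.
exists (complex.Re B) => k l; have := hB k l.
by rewrite e lecE => /andP[_].
Qed.

(** The term equals [(1 + k)^-1 - (2 + k)^-1]. Such weights are comparable to [(1 + k)^-2] and have
    an explicit sum. *)
Lemma sum_telescope n : \sum_(k < n) ((1 + k%:R) * (2 + k%:R))^-1 <= 1 :> R.
Proof.
suff -> : \sum_(k < n) ((1 + k%:R) * (2 + k%:R))^-1 = 1 - (1 + n%:R)^-1 :> R.
  by rewrite gerBl invr_ge0 addr_ge0.
elim: n => [|n IH]; first by rewrite big_ord0 addr0 invr1 subrr.
rewrite big_ord_recr/= IH -natr1.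
by field; rewrite !gt_eqF// ltr_wpDr ?ler0n.
Qed.

(** Decay of order two in each index bounds [m k l] by a multiple of [w k * w l]. The sums of [w]
    are at most [1] and each [nr (c l)] is at most the norm of the vector, so the same multiple
    bounds every section. *)
Lemma rapid_decay_mxbound m : rapid_decay m -> exists C, mxbound m C.
Proof.
move=> /rapid_decay_nr /(_ 2%N 2%N)[B hB].
pose w (k : nat) : R := ((1 + k%:R) * (2 + k%:R))^-1.
have w0 k : 0 <= w k by rewrite invr_ge0 mulr_ge0// addr_ge0.
have B0 : 0 <= B.
  by have := hB 0%N 0%N; apply: le_trans; rewrite !addr0 !expr1n !mul1r nr_ge0.
(* The [4] is a factor [2] for each index, from [(1 + j) * (2 + j) <= 2 * (1 + j) ^+ 2]. *)
have mw k l : nr (m k l) <= 4 * B * (w k * w l).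
  have le j : (1 + j%:R) * (2 + j%:R) <= 2 * (1 + j%:R) ^+ 2 :> R.
    by have : 0 <= j%:R :> R := ler0n _ _; nra.
  have p j : 0 < (1 + j%:R) * (2 + j%:R) :> R by rewrite mulr_gt0// ltr_wpDr ?ler0n.
  rewrite /w -invfM ler_pdivlMr ?mulr_gt0//.
  apply: (@le_trans _ _ (nr (m k l) * ((2 * (1 + k%:R) ^+ 2) * (2 * (1 + l%:R) ^+ 2)))).
    apply: ler_wpM2l; first exact: nr_ge0.
    by apply: ler_pM => //; apply: ltW.
  by have := hB k l; lra.
exists (4 * B) => n c; set S := nr (fsum E n c).
have cS (l : 'I_n) : nr (c l) <= S.
  rewrite -(@ler_sqr R) ?nnegrE ?nr_ge0// (nr_fsum hip hE) (bigD1 l)//=.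
  by rewrite lerDl sumr_ge0// => j _; exact: sqr_ge0.
have S0 : 0 <= S by exact: nr_ge0.
apply: le_trans (nr_sum _ _ _) _.
apply: (@le_trans _ _ (\sum_(k < n) 4 * B * S * w k)).
  apply: ler_sum => k _; rewrite nrZ (nr_basis hip hE) mulr1.
  apply: le_trans (nr_sum _ _ _) _.
  apply: (@le_trans _ _ (\sum_(l < n) 4 * B * S * w k * w l)).
    apply: ler_sum => l _; rewrite nrM.
    apply: le_trans (ler_pM (nr_ge0 _) (nr_ge0 _) (mw k l) (cS l)) _.
    by rewrite le_eqVlt; apply/orP; left; apply/eqP; ring.
  by rewrite -mulr_sumr ler_piMr ?sum_telescope// !mulr_ge0.
by rewrite -mulr_sumr ler_piMr ?sum_telescope// !mulr_ge0.
Qed.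

Lemma rapid_decay_delta m : rapid_decay m -> rapid_decay (mxdelta 1 m).
Proof.
move=> /rapid_decay_nr h; apply/rapid_decay_nr => M N.
have [B hB] := h M.+1 N.+1; exists B => k l; apply: le_trans (hB k l).
rewrite /mxdelta expr1 nrM !exprS.
have : nr (k%:R - l%:R : R[i]) <= (1 + k%:R) * (1 + l%:R).
  apply: le_trans (nrB _ _) _; rewrite !nr_nat.
  by have : 0 <= k%:R :> R := ler0n _ _; have : 0 <= l%:R :> R := ler0n _ _; nra.
move=> kl; rewrite [leLHS](_ : _ = (1 + k%:R) ^+ M * (1 + l%:R) ^+ N * nr (m k l) *
  nr (k%:R - l%:R : R[i])); last ring.
rewrite [leRHS](_ : _ = (1 + k%:R) ^+ M * (1 + l%:R) ^+ N * nr (m k l) *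
  ((1 + k%:R) * (1 + l%:R))); last ring.
by apply: ler_wpM2l => //; rewrite !mulr_ge0 ?nr_ge0 ?exprn_ge0 ?addr_ge0.
Qed.

Lemma rapid_decay_weight N m : rapid_decay m ->
  rapid_decay (fun k l => (1 + l%:R) ^+ N * m k l).
Proof.
move=> /rapid_decay_nr h; apply/rapid_decay_nr => M N'.
have [B hB] := h M (N + N')%N; exists B => k l; apply: le_trans (hB k l).
rewrite nrM nrX nr_1nat exprD le_eqVlt; apply/orP; left; apply/eqP; ring.
Qed.

Lemma rapid_decay_mxnorm M N m : rapid_decay m -> (mxnorm M N m < +oo)%E.
Proof.
elim: M m => [|M IH] m h.
  rewrite mxnorm_0; have [C] := rapid_decay_mxbound (rapid_decay_weight N h).
  by move=> /(mxopnorm_leP hip hE) mC; apply: le_lt_trans mC _; rewrite ltry.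
by rewrite mxnormS lte_add_pinfty ?IH//; exact: rapid_decay_delta.
Qed.

(** Trading the row weight of order [M] for powers of [1 + nr (k - l)] raises the column weight to
    order [M + N], hence the choice of indices [M] and [M + N]. *)
Lemma mxnorm_rapid_decay m : (forall M N, (mxnorm M N m < +oo)%E) -> rapid_decay m.
Proof.
move=> h; apply/rapid_decay_nr => M N.
have f : mxnorm M (M + N) m \is a fin_num by rewrite ge0_fin_numE ?mxnorm_ge0.
exists (fine (mxnorm M (M + N) m)) => k l.
have le : (mxnorm M (M + N) m <= (fine (mxnorm M (M + N) m))%:E)%E by rewrite fineK.
apply: le_trans (mxnorm_coef k l le); apply: ler_wpM2r; first exact: nr_ge0.
rewrite exprD mulrA -exprMn; apply: ler_wpM2r; first by rewrite exprn_ge0// addr_ge0.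
apply: lerXn2r; rewrite ?nnegrE ?mulr_ge0 ?addr_ge0 ?nr_ge0//.
have : nr (k%:R : R[i]) <= nr (k%:R - l%:R : R[i]) + nr (l%:R : R[i]).
  by apply: le_trans (nrD _ _); rewrite subrK.
rewrite !nr_nat => kl; have := ler0n R l; have := nr_ge0 (k%:R - l%:R : R[i]).
by nra.
Qed.

End matrix_norms.

(** * Leibniz rule, product estimate, and membership in [Kinfty] *)

Section operator_norms.
Context {R : realType} {H : completeNormedModType R[i]}.
Context {ip : {dot H for conjC}} (hip : norm_from_dot ip).
Context {E : nat -> H} (hE : orthonormal_basis ip E).
Implicit Types (a b : H -> H) (m : nat -> nat -> R[i]) (C : R).

Local Notation mxopnorm := (mxopnorm ip E).
Local Notation mxnorm := (mxnorm ip E).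
Local Notation mxnorm0 := (mxnorm0 ip E).
Local Notation mxbound := (@mxbound R H E).
Local Notation mxcoef := (mxcoef ip E).

Lemma mxcoef_cst0 : mxcoef (fun=> 0) = fun _ _ => 0.
Proof.
by apply/funext => k; apply/funext => l; rewrite /Defs.mxcoef; exact: linear0l.
Qed.

Lemma mxnorm00 m : mxnorm 0 0 m = mxopnorm m.
Proof.
rewrite mxnorm_0; congr mxopnorm.
by apply/funext => k; apply/funext => l; rewrite expr0 mul1r.
Qed.

(** Lets a matrix such as [delta a] be composed with operators as soon as one of its norms is
    finite. *)
Lemma mxnorm_lt_operator M N m : (mxnorm M N m < +oo)%E ->
  exists2 T, bounded_operator T & mxcoef T = m.
Proof.
move=> h; have : (mxopnorm m < +oo)%E.
  by rewrite -mxnorm00; apply: le_lt_trans h; exact: mxnorm_le.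
move=> /(mxopnorm_finite hip hE)[C _ /(mxbound_operator hip hE)[T [L TC Tm]]].
by exists T; [exact: nr_bounded TC|apply/funext => k; apply/funext => l; exact: Tm].
Qed.

Lemma mxbound_coef_nr a C x : bounded_operator a -> mxbound (mxcoef a) C ->
  nr (a x) <= C * nr x.
Proof.
move=> ba /(mxbound_operator hip hE)[T [L TC Tm]].
by rewrite -(bounded_coef_inj hip hE (nr_bounded L TC) ba Tm).
Qed.

Lemma bounded_coef0 a : bounded_operator a ->
  (forall k l, mxcoef a k l = 0) -> a = fun=> 0.
Proof.
move=> ba a0; apply: (bounded_coef_inj hip hE ba).
  by apply: (@nr_bounded _ _ _ 0) => [u x y|x]; rewrite ?scaler0 ?addr0 ?nr0 ?mul0r.
by move=> k l; rewrite a0 mxcoef_cst0.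
Qed.

(** The Leibniz rule, with [a'] and [b'] standing for [delta a] and [delta b]. The infinite sums
    over the middle index are avoided by truncating [b (E l)] and [b' (E l)] and using continuity of
    [a] and [a']. *)
Lemma mxdelta_comp a b a' b' :
  bounded_operator a -> bounded_operator b ->
  bounded_operator a' -> bounded_operator b' ->
  mxcoef a' = mxdelta 1 (mxcoef a) -> mxcoef b' = mxdelta 1 (mxcoef b) ->
  mxdelta 1 (mxcoef (a \o b)) =
  fun k l => mxcoef (a' \o b) k l + mxcoef (a \o b') k l.
Proof.
move=> ba bb ba' bb' da db; apply/funext => k; apply/funext => l.
rewrite /mxdelta expr1 /Defs.mxcoef/=; set x := b (E l); set y := b' (E l).
have xy i : ip y (E i) = (i%:R - l%:R) * ip x (E i).
  by have := congr1 (fun m => m i l) db; rewrite /mxdelta expr1.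
pose p n z := basis_proj ip E n z.
pose z n := a' (p n x) + a (p n y) - (k%:R - l%:R) *: a (p n x).
have cz : z n @[n --> \oo] --> a' x + a y - (k%:R - l%:R) *: a x.
  have cT T u : bounded_operator T -> (fun n => T (p n u)) @ \oo --> T u.
    by move=> bT; exact: cvg_bounded_operator bT (cvg_proj hip hE u).
  by apply: cvgB; [apply: cvgD; exact: cT|apply: cvgZl_tmp; exact: cT].
(* For each middle index [i] the terms cancel by [(k - i) + (i - l) = k - l]. *)
have hz n : ip (z n) (E k) = 0.
  rewrite ipBl ipDl ipZl !linear_fsum; [|by case: ba|by case: ba|by case: ba'].
  rewrite !ip_suml mulr_sumr -big_split -sumrB big1// => i _.
  rewrite !ipZl xy; have := congr1 (fun m => m k i) da.
  by rewrite /mxdelta expr1 /Defs.mxcoef => ->/=; ring.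
have h0 : (fun n => ip (z n) (E k)) @ \oo --> (0 : R[i]^o).
  by under eq_fun do rewrite hz; exact: cvg_cst.
have h1 := cvg_ip hip (y := E k) cz.
have hd : hausdorff_space R[i]^o := @norm_hausdorff _ _.
have : ip (a' x + a y - (k%:R - l%:R) *: a x) (E k) = 0.
  by rewrite -(cvg_lim hd h1) (cvg_lim hd h0).
by rewrite ipBl ipDl ipZl => /eqP; rewrite subr_eq0 eq_sym => /eqP.
Qed.

(** Induction on [M] over all operators at once, since the Leibniz rule applies the hypothesis to
    the pairs [a', b] and [a, b']. *)
Lemma mxnorm_comp M N a b : bounded_operator a -> bounded_operator b ->
  (mxnorm M 0 (mxcoef a) < +oo)%E -> (mxnorm M N (mxcoef b) < +oo)%E ->
  (mxnorm M N (mxcoef (a \o b)) <= mxnorm M 0 (mxcoef a) * mxnorm M N (mxcoef b))%E.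
Proof.
elim: M a b => [|M IH] a b ba bb.
  rewrite mxnorm00 !mxnorm_0 => /(mxopnorm_finite hip hE)[A -> hA].
  move=> /(mxopnorm_finite hip hE)[C eC hC]; rewrite /Defs.mxnorm0 eC.
  (* [T] is [b] followed on the column side by the weight [(1 + l) ^+ N], so [a \o T] has the
     weighted matrix of [a \o b]. *)
  have [T [LT TC Tm]] := mxbound_operator hip hE hC.
  have TE l : T (E l) = (1 + l%:R) ^+ N *: b (E l).
    by apply: (ip_basis_inj hip hE) => k; rewrite ipZl; exact: Tm.
  have A0 := mxbound_ge0 hip hE hA.
  rewrite -EFinM; apply/(mxopnorm_leP hip hE).
  rewrite (_ : (fun k l => _) = mxcoef (a \o T)).
    apply: (bounded_mxbound hip hE) => [u x y /=|x /=].
      by rewrite LT; case: ba => + _; exact.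
    apply: le_trans (mxbound_coef_nr _ ba hA) _.
    by rewrite -mulrA ler_wpM2l.
  apply/funext => k; apply/funext => l; rewrite /Defs.mxcoef/= TE.
  by rewrite linear_funZ ?ipZl//; case: ba.
move=> ha hb.
have ha0 := le_lt_trans (mxnorm_leS _ _ _) ha.
have hb0 := le_lt_trans (mxnorm_leS _ _ _) hb.
have ha1 := le_lt_trans (mxnorm_delta_le _ _ _) ha.
have hb1 := le_lt_trans (mxnorm_delta_le _ _ _) hb.
have [a' ba' ea] := mxnorm_lt_operator ha1.
have [b' bb' eb] := mxnorm_lt_operator hb1.
rewrite mxnormS (mxdelta_comp ba bb ba' bb' ea eb) (mxnormS M 0).
rewrite (mxnormS M N (mxcoef b)).
rewrite -ea -eb; set A := mxnorm M 0 (mxcoef a); set A' := mxnorm M 0 (mxcoef a').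
set B := mxnorm M N (mxcoef b); set B' := mxnorm M N (mxcoef b').
have A0 : (0 <= A)%E by exact: mxnorm_ge0.
have A'0 : (0 <= A')%E by exact: mxnorm_ge0.
have B0 : (0 <= B)%E by exact: mxnorm_ge0.
have B'0 : (0 <= B')%E by exact: mxnorm_ge0.
(* These are three of the four terms of the expanded right-hand side; the missing [A' * B'] is
   nonnegative. *)
apply: (@le_trans _ _ (A * B + (A' * B + A * B'))%E).
  apply: leeD; first exact: IH.
  apply: le_trans (mxnormD hip hE _ _ _ _) _.
  by apply: leeD; apply: IH => //; rewrite ?ea ?eb.
rewrite ge0_muleDl ?adde_ge0// !ge0_muleDr// addeA (addeAC _ _ (A * B')%E).
rewrite addeA leeDl// mule_ge0//.
Qed.

Lemma mxnorm_cst0 M N : mxnorm M N (fun _ _ => 0) = 0%E.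
Proof.
elim: M => [|M IH].
  rewrite mxnorm_0; apply/eqP; rewrite eq_le mxnorm0_ge0 andbT.
  apply/(mxopnorm_leP hip hE) => n c; rewrite mul0r (_ : fsum E n _ = 0) ?nr0//.
  apply: big1 => k _; rewrite /mxapply big1 ?scale0r// => l _.
  by rewrite mulr0 mul0r.
rewrite mxnormS IH add0e -[RHS]IH; congr mxnorm.
by apply/funext => k; apply/funext => l; rewrite /mxdelta mulr0.
Qed.

Lemma mxnorm_eq0 M N m : mxnorm M N m = 0%E -> forall k l, m k l = 0.
Proof.
move=> h k l; apply: nr_eq0; apply: le_anti; rewrite nr_ge0 andbT.
have : (mxnorm M N m <= 0%:E)%E by rewrite h.
move=> /(mxnorm_coef hip hE k l); rewrite pmulr_rle0//.
by rewrite mulr_gt0// exprn_gt0// ltr_wpDr ?nr_ge0 ?ler0n.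
Qed.

(** Zero norms are treated before infinite ones: [0 * +oo] is [0], so the left side must vanish
    there, and it does because a zero norm forces a zero operator. *)
Lemma mxnorm_comp_le M N a b : bounded_operator a -> bounded_operator b ->
  (mxnorm M N (mxcoef (a \o b)) <= mxnorm M 0 (mxcoef a) * mxnorm M N (mxcoef b))%E.
Proof.
move=> ba bb.
have comp0 : a \o b = (fun=> 0) ->
    (mxnorm M N (mxcoef (a \o b)) <= mxnorm M 0 (mxcoef a) * mxnorm M N (mxcoef b))%E.
  by move=> ->; rewrite mxcoef_cst0 mxnorm_cst0 mule_ge0 ?mxnorm_ge0.
have [a0|a0] := eqVneq (mxnorm M 0 (mxcoef a)) 0%E.
  apply: comp0; apply/funext => x /=.
  by rewrite (bounded_coef0 ba (mxnorm_eq0 a0)).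
have [b0|b0] := eqVneq (mxnorm M N (mxcoef b)) 0%E.
  apply: comp0; apply/funext => x /=.
  by rewrite (bounded_coef0 bb (mxnorm_eq0 b0)) linear_fun0//; case: ba.
have a_gt0 : (0 < mxnorm M 0 (mxcoef a))%E by rewrite lt_neqAle eq_sym a0 mxnorm_ge0.
have b_gt0 : (0 < mxnorm M N (mxcoef b))%E by rewrite lt_neqAle eq_sym b0 mxnorm_ge0.
have [ha|] := ltP (mxnorm M 0 (mxcoef a)) +oo%E; last first.
  by rewrite leye_eq => /eqP ->; rewrite gt0_mulye// leey.
have [hb|] := ltP (mxnorm M N (mxcoef b)) +oo%E; last first.
  by rewrite leye_eq => /eqP ->; rewrite gt0_muley// leey.
exact: mxnorm_comp.
Qed.

Lemma Kinfty_partial_sum (c : nat -> nat -> R[i]) n x :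
  \sum_(k < n) \sum_(l < n) c k l *: P_ ip E k l x =
  fsum E n (mxapply c n (fun l => ip x (E l))).
Proof.
apply: eq_bigr => k _; rewrite /mxapply scaler_suml; apply: eq_bigr => l _.
by rewrite /P_ scalerA.
Qed.

(** The coefficients of the series are forced to be those of [a], because the entry of a partial sum
    at [k, l] is constant once [n] exceeds both indices. *)
Lemma KinftyP a : Kinfty ip E a <-> bounded_operator a /\ rapid_decay (mxcoef a).
Proof.
split=> [[ba [c hc cvc]]|[ba hc]]; split=> //.
  suff -> : mxcoef a = c by [].
  apply/funext => k; apply/funext => l.
  have hd : hausdorff_space R[i]^o := @norm_hausdorff _ _.
  have h := cvg_ip hip (y := E k) (cvc (E l)).
  rewrite /Defs.mxcoef -(cvg_lim hd h).
  apply: (cvg_lim hd); apply: cvg_near_cst.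
  exists (maxn k l).+1 => // n /=; rewrite gtn_max => /andP[kn ln].
  rewrite Kinfty_partial_sum (ip_fsum hE) kn /mxapply (bigD1 (Ordinal ln))//=.
  rewrite (ip_basis hE) eqxx mulr1 big1 ?addr0// => j.
  by rewrite -(inj_eq val_inj)/= (ip_basis hE) eq_sym => /negbTE ->; rewrite mulr0.
exists (mxcoef a) => // x; apply/cvg_nrP => e e0.
have /cvg_nrP /(_ (e / 2)) := cvg_bounded_operator ba (cvg_proj hip hE x).
rewrite divr_gt0// => /(_ isT)[n1 h1].
have /cvg_nrP /(_ (e / 2)) := @cvg_proj _ _ _ hip _ hE (a x).
rewrite divr_gt0// => /(_ isT)[n2 h2].
exists (maxn n1 n2) => n; rewrite geq_max => /andP[/h1 {}h1 /h2 {}h2].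
rewrite Kinfty_partial_sum.
(* The partial sum is [a] compressed by the projection on both sides; the outer projection is a
   contraction, so both errors stay below [e / 2]. *)
rewrite (_ : fsum E n _ = basis_proj ip E n (a (basis_proj ip E n x))).
  apply: le_trans (nr_tri _ (basis_proj ip E n (a x)) _) _.
  rewrite -projB; have := nr_proj hip hE n (a (basis_proj ip E n x) - a x).
  lra.
apply: eq_fsum => k _; rewrite linear_fsum ?ip_suml//; last by case: ba.
by apply: eq_bigr => l _; rewrite ipZl mulrC.
Qed.

Lemma Kinfty_normP a : bounded_operator a ->
  Kinfty ip E a <-> forall M N, (norm_MN ip E M N a < +oo)%E.
Proof.
move=> ba; split=> [/KinftyP[_ hc] M N|h]; first exact: rapid_decay_mxnorm.
by apply/KinftyP; split=> //; exact: (mxnorm_rapid_decay hip hE h).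
Qed.

Lemma mxcoef_adjoint a a' : is_adjoint ip a a' ->
  mxcoef a' = fun k l => conjC (mxcoef a l k).
Proof.
move=> h; apply/funext => k; apply/funext => l.
by rewrite /Defs.mxcoef (ipC (a' _)) h.
Qed.

End operator_norms.

(** * The topology of [kinfty] *)

Section topology.
Context {R : realType} {H : completeNormedModType R[i]}.
Context {ip : {dot H for conjC}} (hip : norm_from_dot ip).
Context {E : nat -> H} (hE : orthonormal_basis ip E).
Local Notation K := (kinfty ip E).
Local Notation mxnorm := (mxnorm ip E).
Local Notation mxcoef := (mxcoef ip E).
Implicit Types (x y : K) (e : R).

Lemma kinfty_funD x y : kinfty_fun (x + y) = kinfty_fun x + kinfty_fun y.
Proof. exact: (raddfD (\val : K -> H -> H)). Qed.

Lemma kinfty_funN x : kinfty_fun (- x) = - kinfty_fun x.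
Proof. exact: (raddfN (\val : K -> H -> H)). Qed.

Lemma kinfty_funZ (z : R[i]) x : kinfty_fun (z *: x) = z *: kinfty_fun x.
Proof. by []. Qed.

Definition kcoef x := mxcoef (kinfty_fun x).

Lemma kcoefD x y : kcoef (x + y) = fun k l => kcoef x k l + kcoef y k l.
Proof.
apply/funext => k; apply/funext => l.
by rewrite /kcoef kinfty_funD /Defs.mxcoef fctE ipDl.
Qed.

Lemma kcoefZ (z : R[i]) x : kcoef (z *: x) = fun k l => z * kcoef x k l.
Proof.
apply/funext => k; apply/funext => l.
by rewrite /kcoef kinfty_funZ /Defs.mxcoef fctE [LHS]ipZl.
Qed.

Lemma kcoefN x : kcoef (- x) = fun k l => - kcoef x k l.
Proof.
rewrite -scaleN1r kcoefZ; apply/funext => k; apply/funext => l.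
by rewrite mulN1r.
Qed.

Lemma kcoefB x y : kcoef (x - y) = fun k l => kcoef x k l - kcoef y k l.
Proof. by rewrite kcoefD kcoefN. Qed.

Lemma kinfty_bounded x : bounded_operator (kinfty_fun x).
Proof. by have /set_mem[] := kinfty_funP x. Qed.

Definition knorm M N x : R := fine (norm_MN ip E M N (kinfty_fun x)).

Lemma knormE M N x : norm_MN ip E M N (kinfty_fun x) = (knorm M N x)%:E.
Proof.
rewrite fineK// ge0_fin_numE ?mxnorm_ge0//.
by have /(Kinfty_normP hip hE (kinfty_bounded x)) := set_mem (kinfty_funP x); exact.
Qed.

Lemma mxnorm_kcoef M N x : mxnorm M N (kcoef x) = (knorm M N x)%:E.
Proof. exact: knormE. Qed.

Lemma knorm_ge0 M N x : 0 <= knorm M N x.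
Proof. by rewrite -lee_fin -knormE mxnorm_ge0. Qed.

Lemma knormD M N x y : knorm M N (x + y) <= knorm M N x + knorm M N y.
Proof.
rewrite -lee_fin EFinD -!mxnorm_kcoef kcoefD; exact: (mxnormD hip hE).
Qed.

Lemma knormN M N x : knorm M N (- x) = knorm M N x.
Proof. by apply: EFin_inj; rewrite -!mxnorm_kcoef kcoefN (mxnormN hip hE). Qed.

Lemma knorm_distC M N x y : knorm M N (x - y) = knorm M N (y - x).
Proof. by rewrite -knormN opprB. Qed.

Lemma knorm_tri M N x y z : knorm M N (x - z) <= knorm M N (x - y) + knorm M N (y - z).
Proof. by apply: le_trans (knormD _ _ _ _); rewrite addrA subrK. Qed.

Lemma knormZ M N (z : R[i]) x : knorm M N (z *: x) <= nr z * knorm M N x.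
Proof.
rewrite -lee_fin EFinM -!mxnorm_kcoef kcoefZ; apply: (mxnormZ hip hE).
by rewrite mxnorm_kcoef ltry.
Qed.

Lemma knorm_le M M' N N' x : (M <= M')%N -> (N <= N')%N ->
  knorm M N x <= knorm M' N' x.
Proof.
by move=> MM NN; rewrite -lee_fin -!mxnorm_kcoef; exact: (mxnorm_le hip hE).
Qed.

Lemma knorm0 M N : knorm M N 0 = 0.
Proof.
apply/le_anti; rewrite knorm_ge0 andbT.
by have := knormZ M N 0 0; rewrite scaler0 nr0 mul0r.
Qed.

Lemma nr_kinfty_fun x v : nr (kinfty_fun x v) <= knorm 0 0 x * nr v.
Proof.
apply: (mxbound_coef_nr hip hE v (kinfty_bounded x)).
by apply/(mxopnorm_leP hip hE); rewrite -mxnorm00 mxnorm_kcoef.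
Qed.

Lemma knorm_eq0 x : knorm 0 0 x = 0 -> x = 0.
Proof.
move=> x0; apply: val_inj; apply/funext => v; apply: nr_eq0; apply/le_anti.
by rewrite nr_ge0 andbT; have := nr_kinfty_fun x v; rewrite x0 mul0r.
Qed.

(** A single ball suffices where a family of norms would call for finite intersections: the norms
    increase in both indices, so they are directed. *)
Definition knorm_nbhs x (U : set K) := exists M N e,
  0 < e /\ forall y, knorm M N (y - x) < e -> U y.

Lemma knorm_nbhsI x U V : knorm_nbhs x U -> knorm_nbhs x V -> knorm_nbhs x (U `&` V).
Proof.
move=> [M [N [e [e0 hU]]]] [M' [N' [e' [e0' hV]]]].
exists (maxn M M'), (maxn N N'), (Num.min e e'); split.
  by rewrite lt_min e0.
move=> y; rewrite lt_min => /andP[h h']; split.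
  by apply: hU; apply: le_lt_trans h; apply: knorm_le; rewrite leq_maxl.
by apply: hV; apply: le_lt_trans h'; apply: knorm_le; rewrite leq_maxr.
Qed.

Lemma Kinfty_ballE M N e x y :
  Kinfty_ball (M, N, e, x) y <-> knorm M N (y - x) < e.
Proof. by rewrite -lte_fin -knormE. Qed.

Lemma Kinfty_ball_nbhs (i : nat * nat * R * K) x : Kinfty_ball i x ->
  knorm_nbhs x (Kinfty_ball i).
Proof.
case: i => [[[M N] e] z] /Kinfty_ballE h.
exists M, N, (e - knorm M N (x - z)); split; first by rewrite subr_gt0.
move=> y hy; apply/Kinfty_ballE; apply: le_lt_trans (knorm_tri _ _ _ x _) _.
by lra.
Qed.

Lemma open_Kinfty_ball (i : nat * nat * R * K) : 0 < i.1.2 ->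
  open (Kinfty_ball i : set K).
Proof.
move=> i0; exists [set (Kinfty_ball i : set K)]; last by rewrite bigcup_set1.
by move=> _ ->; exact: finI_from1.
Qed.

(** An open set is a union of finite intersections of balls with arbitrary centres. Each ball
    containing [x] contains one centred at [x], and finitely many of those merge by raising indices
    and shrinking radii. *)
Lemma nbhs_kinftyP x (U : set K) : nbhs x U <-> knorm_nbhs x U.
Proof.
split=> [|[M [N [e [e0 h]]]]]; last first.
  rewrite nbhsE; exists (Kinfty_ball (M, N, e, x)) => [|y /Kinfty_ballE]; last exact: h.
  split; first exact: open_Kinfty_ball.
  by apply/Kinfty_ballE; rewrite subrr knorm0.
rewrite nbhsE => -[B [oB Bx] BU].
case: oB => D sD BE; move: Bx; rewrite -BE => -[A DA Ax].
have [S Spos SA] := sD _ DA.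
have {}BU : A `<=` U by move=> y Ay; apply: BU; rewrite -BE; exists A.
have good (s : seq (nat * nat * R * K)) : (forall i, i \in s -> Kinfty_ball i x) ->
    knorm_nbhs x [set y | forall i, i \in s -> Kinfty_ball i y].
  elim: s => [|i s IH] hs; first by exists 0%N, 0%N, 1; split.
  have h1 := Kinfty_ball_nbhs (hs i (mem_head _ _)).
  have [|M [N [e [e0 h]]]] := knorm_nbhsI h1 (IH _).
    by move=> j js; apply: hs; rewrite in_cons js orbT.
  exists M, N, e; split=> // y /h[yi ys] j; rewrite in_cons => /predU1P[->//|].
  exact: ys.
have [|M [N [e [e0 h]]]] := good (finmap.enum_fset S).
  by move=> i iS; move: Ax; rewrite -SA; apply.
exists M, N, e; split=> // y /h hy; apply: BU; rewrite -SA => i; exact: hy.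
Qed.

Lemma kinfty_tvs : topological_vector_space (K : preTopologicalLmodType R[i]).
Proof.
split=> [[x y]|[z x]] U /= /nbhs_kinftyP[M [N [e [e0 h]]]].
  pose B u := [set v : K | knorm M N (v - u) < e / 2].
  have nB u : nbhs u (B u).
    by apply/nbhs_kinftyP; exists M, N, (e / 2); rewrite divr_gt0.
  exists (B x, B y) => [|[x' y'] [/= hx hy]]; first by split; exact: nB.
  apply: h => /=; rewrite opprD addrACA; apply: le_lt_trans (knormD _ _ _ _) _.
  by move: hx hy; rewrite /B/=; lra.
set r := knorm M N x.
have r0 : 0 <= r := knorm_ge0 _ _ _.
have z0 := nr_ge0 z.
(* In [z' *: (x' - x) + (z' - z) *: x] each term gets [e / 2]. The minimum with [1] bounds [nr z']
   by [nr z + 1]; the [+ 1] in [r + 1] makes the second share strict. *)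
pose d := Num.min 1 (e / (2 * (r + 1))).
pose d' := e / (2 * (nr z + 1)).
have d0 : 0 < d by rewrite lt_min ltr01 divr_gt0// mulr_gt0//; lra.
have d0' : 0 < d' by rewrite divr_gt0// mulr_gt0//; lra.
exists ([set z' : R[i]^o | nr (z' - z) < d], [set x' : K | knorm M N (x' - x) < d']).
  split=> /=; last by apply/nbhs_kinftyP; exists M, N, d'.
  apply/nbhs_ballP; exists d%:C; first by rewrite /= ltcR.
  by move=> z'; rewrite -ball_normE/= nrE ltcR nr_distC.
move=> [z' x'] [/= hz hx]; apply: h => /=.
have -> : z' *: x' - z *: x = z' *: (x' - x) + (z' - z) *: x.
  by rewrite scalerBr scalerBl addrA subrK.
apply: le_lt_trans (knormD _ _ _ _) _.
have hz' : nr z' < nr z + 1.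
  have : nr (z' - z) < 1 by move: hz; rewrite lt_min => /andP[].
  by have := nrD (z' - z) z; rewrite subrK; lra.
have h1 := knormZ M N z' (x' - x); have h2 := knormZ M N (z' - z) x.
have h3 : nr z' * knorm M N (x' - x) <= (nr z + 1) * d'.
  by apply: ler_pM; rewrite ?nr_ge0 ?knorm_ge0 ?(ltW hz') ?(ltW hx).
have h4 : nr (z' - z) * r <= e / (2 * (r + 1)) * r.
  by apply: ler_wpM2r => //; apply: ltW; move: hz; rewrite lt_min => /andP[].
have h5 : (nr z + 1) * d' = e / 2 by rewrite /d'; field; rewrite gt_eqF//; lra.
have h6 : e / (2 * (r + 1)) * r < e / 2.
  rewrite -subr_gt0 (_ : _ - _ = e / (2 * (r + 1))); last first.
    by field; rewrite gt_eqF//; lra.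
  by rewrite divr_gt0// mulr_gt0//; lra.
by rewrite -/r in h2; lra.
Qed.

Lemma kinfty_hausdorff : hausdorff_space K.
Proof.
move=> x y xy; apply/eqP; rewrite -subr_eq0; apply/eqP/knorm_eq0/le_anti.
rewrite knorm_ge0 andbT; apply/ler_addgt0Pr => e e0; rewrite add0r.
pose B u := [set v : K | knorm 0 0 (v - u) < e / 2].
have nB u : nbhs u (B u).
  by apply/nbhs_kinftyP; exists 0%N, 0%N, (e / 2); rewrite divr_gt0.
have [z [/= xz yz]] := xy _ _ (nB x) (nB y).
apply: le_trans (knorm_tri _ _ _ z _) _; rewrite knorm_distC.
by move: xz yz; rewrite /B/=; lra.
Qed.

(** * Entrywise limits of matrices along a filter *)

Section matrix_limit.
Context {I : Type} (F : set_system I) {FF : ProperFilter F}.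
Implicit Types (mm : I -> nat -> nat -> R[i]) (m : nat -> nat -> R[i]) (C : R).

Definition mxlimit mm m := forall k l (e : R), 0 < e ->
  F [set i | nr (mm i k l - m k l) <= e].

Lemma mxlimit_scale (w : nat -> nat -> R[i]) mm m : mxlimit mm m ->
  mxlimit (fun i k l => w k l * mm i k l) (fun k l => w k l * m k l).
Proof.
move=> h k l e e0; have w0 := nr_ge0 (w k l).
have w1 : 0 < nr (w k l) + 1 by lra.
apply: filterS (h k l (e / (nr (w k l) + 1)) _); last by rewrite divr_gt0.
move=> i /=; rewrite ler_pdivlMr// -mulrBr nrM => le.
by have := nr_ge0 (mm i k l - m k l); nra.
Qed.

(** A section involves finitely many entries, so a single index makes all of them close to their
    limits. *)
Lemma mxbound_limit mm m C : mxlimit mm m ->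
  F [set i | mxbound (E := E) (mm i) C] -> mxbound (E := E) m C.
Proof.
move=> hm hF n c; apply/ler_addgt0Pr => e e0.
(* Changing every entry of the section by at most [t] moves its value at [c] by at most [t * S]. *)
pose S := \sum_(k < n) \sum_(l < n) nr (c l).
have S0 : 0 <= S by apply: sumr_ge0 => k _; apply: sumr_ge0 => l _; exact: nr_ge0.
have S1 : 0 < S + 1 by lra.
have hn : F [set i | forall p : 'I_n * 'I_n,
    nr (mm i p.1 p.2 - m p.1 p.2) <= e / (S + 1)].
  by apply: filter_forall => p; apply: hm; rewrite divr_gt0.
have [i [/= hi hB]] := filter_ex (filterI hn hF).
have -> : fsum E n (mxapply m n c) = fsum E n (mxapply (mm i) n c) -
    fsum E n (mxapply (fun k l => mm i k l - m k l) n c).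
  rewrite -fsumB; apply: eq_fsum => k _; rewrite /mxapply -sumrB.
  by apply: eq_bigr => l _; ring.
apply: le_trans (nrB _ _) _; apply: lerD; first exact: hB.
apply: le_trans (nr_sum _ _ _) _.
apply: (@le_trans _ _ (e / (S + 1) * S)); last first.
  by rewrite mulrAC ler_pdivrMr// ler_wpM2l ?ltW//; lra.
rewrite /S mulr_sumr; apply: ler_sum => k _; rewrite nrZ (nr_basis hip hE) mulr1.
apply: le_trans (nr_sum _ _ _) _; rewrite mulr_sumr; apply: ler_sum => l _.
by rewrite nrM ler_wpM2r ?nr_ge0//; exact: (hi (k, l)).
Qed.

(** Both summands of [mxnormS] are bounded by [C] along the filter, and the induction treats them
    separately, so each step doubles the constant. *)
Lemma mxnorm_limit M N mm m C : mxlimit mm m ->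
  F [set i | (mxnorm M N (mm i) <= C%:E)%E] -> (mxnorm M N m <= (2 ^+ M * C)%:E)%E.
Proof.
elim: M mm m => [|M IH] mm m hm hF.
  rewrite mxnorm_0 expr0 mul1r; apply/(mxopnorm_leP hip hE).
  apply: (mxbound_limit (mxlimit_scale (fun _ l => (1 + l%:R) ^+ N) hm)).
  by apply: filterS hF => i /=; rewrite mxnorm_0 => /(mxopnorm_leP hip hE).
rewrite mxnormS exprS -mulrA mulr_natl mulr2n EFinD; apply: leeD.
  by apply: IH hm _; apply: filterS hF => i /=; apply: le_trans; exact: mxnorm_leS.
apply: IH (mxlimit_scale (fun k l => (k%:R - l%:R) ^+ 1) hm) _.
by apply: filterS hF => i /=; apply: le_trans; exact: mxnorm_delta_le.
Qed.

End matrix_limit.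

(** The norm with indices [0, 0] controls the operator norm, so the filter converges on each basis
    vector. The limits are the columns of a matrix [m], to which the filter converges in every norm;
    finiteness of all norms of [m] makes it the matrix of an element of [kinfty]. *)
Lemma kinfty_complete : tvs_complete (K : preTopologicalLmodType R[i]).
Proof.
move=> F FF Fc.
have cauchyF M N (e : R) : 0 < e -> exists2 A : set K, F A &
    forall x y, A x -> A y -> knorm M N (x - y) < e.
  move=> e0; apply: (Fc [set x | knorm M N x < e]); apply/nbhs_kinftyP.
  by exists M, N, e; split=> // y; rewrite subr0.
have cvF l : cvg ((fun x => kinfty_fun x (E l)) @ F).
  apply/cauchy_cvgP/cauchy_ballP => _ /gt0_complexP[e e0 ->].
  have [A FA hA] := cauchyF 0%N 0%N e e0.
  exists ([set kinfty_fun x (E l) | x in A], [set kinfty_fun x (E l) | x in A]).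
    by split; apply: (@filterS _ F _ A) FA => x Ax; exists x.
  move=> [_ _] /= [[x Ax <-] [y Ay <-]]; rewrite -ball_normE/= nrE ltcR.
  apply: le_lt_trans (hA x y Ax Ay).
  have := nr_kinfty_fun (x - y) (E l).
  by rewrite (nr_basis hip hE) mulr1 kinfty_funD kinfty_funN.
pose m k l := ip (lim ((fun x => kinfty_fun x (E l)) @ F)) (E k).
have hm : mxlimit F kcoef m.
  move=> k l e e0; have /cvgrPdist_le /(_ e%:C) := cvF l.
  rewrite ltcR => /(_ e0); apply: filterS => x /=; rewrite nrE lecR => h.
  rewrite /kcoef /m /Defs.mxcoef -ipBl; apply: le_trans (nr_ip_le hip _ _) _.
  by rewrite (nr_basis hip hE) mulr1 nr_distC.
have lim_le M N e : 0 < e -> exists2 A : set K, F A & forall y, A y ->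
    (mxnorm M N (fun k l => kcoef y k l - m k l)%R <= e%:E)%E.
  (* The division by [2 ^+ M] offsets the constant of [mxnorm_limit]. *)
  move=> e0; have [|A FA hA] := cauchyF M N (e / 2 ^+ M).
    by rewrite divr_gt0// exprn_gt0.
  exists A => // y Ay.
  have -> : e = 2 ^+ M * (e / 2 ^+ M) by rewrite mulrC divfK// gt_eqF// exprn_gt0.
  (* Here [y] is fixed and [x] runs along the filter. *)
  apply: (@mxnorm_limit _ F _ M N (fun x => kcoef (y - x))).
    move=> k l d d0; apply: filterS (hm k l d d0) => x /=.
    rewrite kcoefB -(nrN (kcoef x k l - m k l)).
    by congr (nr _ <= d); ring.
  apply: filterS FA => x Ax /=; rewrite mxnorm_kcoef lee_fin ltW//.
  exact: hA.
have m_lt M N : (mxnorm M N m < +oo)%E.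
  have [A FA hA] := lim_le M N 1 ltr01; have [y Ay] := filter_ex FA.
  (* Finiteness is inherited from any [y] at distance at most [1] from [m]. *)
  have -> : m = fun k l => kcoef y k l + - (kcoef y k l - m k l).
    by apply/funext => k; apply/funext => l; rewrite opprB addrC subrK.
  apply: le_lt_trans (mxnormD hip hE _ _ _ _) _.
  rewrite (mxnormN hip hE) lte_add_pinfty ?mxnorm_kcoef ?ltry//.
  by apply: le_lt_trans (hA y Ay) _; rewrite ltry.
have [a ba am] := mxnorm_lt_operator hip hE (m_lt 0%N 0%N).
have Ka : Kinfty ip E a.
  by apply/(Kinfty_normP hip hE ba) => M N; rewrite /norm_MN am.
pose x : K := MkKinfty (mem_set Ka : a \in Kinfty_pred ip E).
exists x => U /nbhs_kinftyP[M [N [e [e0 h]]]].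
have [|A FA hA] := lim_le M N (e / 2); first by rewrite divr_gt0.
apply: filterS FA => y Ay; apply: h.
have := hA y Ay; rewrite -am -[Defs.mxcoef _ _ a]/(kcoef x).
by rewrite -kcoefB mxnorm_kcoef lee_fin; lra.
Qed.

End topology.

Theorem proposition2p3 (R : realType) (H : completeNormedModType R[i])
    (ip : {dot H for conjC}) (hip : norm_from_dot ip)
    (E : nat -> H) (hE : orthonormal_basis ip E) :
  (forall (a b : H -> H) (M N : nat),
      bounded_operator a -> bounded_operator b ->
    (Kinfty ip E a <-> forall M' N' : nat, (norm_MN ip E M' N' a < +oo)%E) /\
    (norm_MN ip E M.+1 N a
       = norm_MN ip E M N a + norm_MN_delta ip E M N a)%E /\
    (norm_MN ip E M N a <= norm_MN ip E M N.+1 a)%E /\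
    ((norm_MN ip E M N (a \o b)
        <= norm_MN ip E M 0 a * norm_MN ip E M N b)%E /\
     (norm_MN ip E M 0 a * norm_MN ip E M N b
        <= norm_MN ip E M N a * norm_MN ip E M N b)%E) /\
    (norm_MN_delta ip E M N a <= norm_MN ip E M.+1 N a)%E /\
    (forall a' : H -> H, is_adjoint ip a a' ->
       (norm_MN ip E M N a' <= norm_MN ip E (M + N) N a)%E)) /\
  (topological_vector_space (kinfty ip E) /\
   tvs_complete (kinfty ip E) /\
   hausdorff_space (kinfty ip E)).
Proof.
split; last first.
  split; first exact: kinfty_tvs.
  by split; [exact: kinfty_complete|exact: kinfty_hausdorff].
move=> a b M N ba bb; split; first exact: Kinfty_normP.
split; first exact: mxnormS.
split; first exact: mxnorm_le.
split.
  split; first exact: mxnorm_comp_le.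
  by apply: lee_wpmul2r; [exact: mxnorm_ge0|exact: mxnorm_le].
split; first exact: mxnorm_delta_le.
move=> a' /mxcoef_adjoint a'E; rewrite /norm_MN a'E; exact: mxnorm_adj.
Qed.
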